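(* Let $X\ge 0$ be a random variable with distribution function $F$ (all of whose moments are finite), and suppose its moments $m_k=\mathbf{E}[X^k]$ satisfy $m_k=\mathcal{O}(k^{ak})$ as $k\to\infty$ for some constant $a\in(0,2]$. Then the following two statements hold. (i) $X$ satisfies Hardy's condition, and hence $X$ is M-det. (ii) The boundary value $a=2$ is the best possible for $X$ to be M-det. In fact, there is an M-indet random variable $\tilde X\ge 0$ such that $\mathbf{E}[\tilde X^k]=\mathcal{O}(k^{ak})$ as $k\to\infty$ for all $a>2$.
   Context: All random variables are assumed to have finite moments of all positive orders: $\mathbf{E}[|X|^k]<\infty$ for $k=1,2,\ldots$. A random variable $X$ with distribution function $F$ and moments $m_k=\mathbf{E}[X^k]$ is called moment determinate (M-det) if $F$ is the only distribution having the moment sequence $\{m_k\}_{k=1}^\infty$; otherwise it is called moment indeterminate (M-indet). A nonnegative random variable $X$ satisfies Hardy's condition if $\mathbf{E}[e^{c\sqrt{X}}]<\infty$ for some constant $c>0$. *)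

(* Defs.v *)
From HB Require Import structures.
From mathcomp Require Import all_boot all_order all_algebra.
From mathcomp Require Import all_classical all_reals all_analysis.

Set Implicit Arguments.
Unset Strict Implicit.
Unset Printing Implicit Defensive.

Import Order.TTheory GRing.Theory Num.Theory.
Import numFieldNormedType.Exports.

Local Open Scope classical_set_scope.
Local Open Scope ring_scope.

Section moments.
Context (d : measure_display) (T : measurableType d) (R : realType).
Context (P : probability T R) (X : {RV P >-> R}).

Definition finite_moments : Prop :=
  forall k : nat, (0 < k)%N -> ('E_P[fun w => (`|X w| ^+ k)%R] < +oo)%E.

(* [fine] sends infinite values to 0, so this is meaningful only together
   with [finite_moments] *)
Definition moment (k : nat) : R := fine 'E_P[fun w => (X w ^+ k)%R].

Definition hardy_condition : Prop :=
  exists2 c : R, 0 < c & ('E_P[fun w => (expR (c * Num.sqrt (X w)))%R] < +oo)%E.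

End moments.

(* A distribution is represented by the random variables that have it; the
   competitor Y lives on an arbitrary probability space and is not assumed to
   be nonnegative (uniqueness among all distributions on the real line). *)
Definition M_det (R : realType) (d : measure_display) (T : measurableType d)
    (P : probability T R) (X : {RV P >-> R}) : Prop :=
  forall (d' : measure_display) (T' : measurableType d')
    (Q : probability T' R) (Y : {RV Q >-> R}),
  finite_moments Y ->
  (forall k : nat, (0 < k)%N -> moment Y k = moment X k) ->
  cdf Y = cdf X.

Definition M_indet (R : realType) (d : measure_display) (T : measurableType d)
    (P : probability T R) (X : {RV P >-> R}) : Prop := ~ M_det X.

Definition moment_growth (R : realType) (d : measure_display)
    (T : measurableType d) (P : probability T R) (X : {RV P >-> R})
    (a : R) : Prop :=
  (fun k : nat => moment X k) =O_\oo (fun k : nat => k%:R `^ (a * k%:R) : R).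

(* Main.v *)
Require Import Defs.
From HB Require Import structures.
From mathcomp Require Import all_boot all_order all_algebra.
From mathcomp Require Import all_classical all_reals all_analysis.
From mathcomp Require Import measurable_realfun zify ring lra.
Import Order.TTheory GRing.Theory Num.Theory.
Import numFieldNormedType.Exports.
Local Open Scope ring_scope.
Local Open Scope classical_set_scope.

Set Implicit Arguments.
Unset Strict Implicit.
Unset Printing Implicit Defensive.

(** Throughout, [m k] is the [k]-th moment of [X >= 0].

    Determinacy.  The bound [m k <= C k^(2k)] says that [sqrt X] has moments
    [O(n^n)], so summing the exponential series gives
    [E exp (c sqrt X) < oo] ([integrable_expR_of_moments]).  A competitor [Y]
    with the same moments may take negative values, but
    [E Y^(2k) = m (2k) <= C (2k)^(4k)] bounds all absolute moments of [Y], and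
    [E exp (c sqrt |Y|) < oo] follows in the same way.  The function
    [x |-> cos (t sqrt x) = sum_k (-1)^k t^(2k) x^k / (2k)!] is entire in [x];
    it is bounded on the positive half-line and equals [cosh (t sqrt (- x))] on
    the negative one.  For small [t] its expectations under [X] and [Y] agree
    because the moments do.  The agreement is carried to every [t >= 0] by
    analytic continuation in steps of length at most [c / 2]
    ([kernel_identity_all]): the identity is maintained for all derivatives in
    [t] at once, the bounded part has a Taylor expansion by dominated
    convergence, and the part coming from [Y < 0] has nonnegative Taylor
    coefficients, so that the convergence of its expansion forces it to be
    finite further on.  Hence [E (cosh (t sqrt (- Y)); Y < 0) <= 2] for every
    [t], which is possible only if [Y >= 0] almost surely ([ae_nonneg]), and
    [E cos (t sqrt X) = E cos (t sqrt Y)] for all [t]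
    ([Rintegral_cos_sqrt_eq]).  Finally the cosine transform determines a law on
    the half-line ([tail_of_cosine_transform]): products of cosines are sums of
    cosines, so the expectations of every polynomial in [cos (s u)] agree, and
    suitable polynomials converge boundedly to indicators of half-lines.

    Sharpness.  Let [x_n = ((n+1)(1 + ln (n+1)))^2].  By Lagrange interpolation
    of [X^k] at [x_0, ..., x_(N-1)], the weights
    [(-1)^n x_n / prod_(m < N, m <> n) |1 - x_n / x_m|] have vanishing power sums
    of every order [k <= N - 2] ([node_weight_power_sum]).  Their absolute
    values increase with [N] and are bounded by
    [2 x_n exp (- ln 2 * n / (1 + ln (n+1)))] ([node_weight_le]): for the exact
    squares the products are at least [1/2], and the slowly varying factor
    [1 + ln (n+1)] provides the exponential gain.  In the limit there is a
    positive summable sequence [w_n] such that [sum_n (-1)^n w_n x_n^k = 0] for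
    all [k].  The law [P] giving [x_n] a mass proportional to [w_n], and the law
    with density [1 + (-1)^n] with respect to it, are different and have the
    same moments; these moments are [O(k^(ak))] for every [a > 2] because,
    up to logarithms, [x_n] is of order [n^2] and [- ln w_n] at least of order
    [n] ([node_moment_le], [growth_bound_le]). *)

(** * Integration *)

Lemma Rintegral_dominated_cvg (d : measure_display) (T : measurableType d)
    (R : realType) (mu : {measure set T -> \bar R})
    (f_ : nat -> T -> R) (f g : T -> R) :
  (forall n, measurable_fun setT (f_ n)) ->
  (forall x, f_ n x @[n --> \oo] --> f x) ->
  mu.-integrable setT (EFin \o g) ->
  (forall n x, `|f_ n x| <= g x) ->
  mu.-integrable setT (EFin \o f) /\
  \int[mu]_(x in setT) f_ n x @[n --> \oo] --> \int[mu]_(x in setT) f x.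
Proof.
move=> mf_ f_f ig f_g.
have [intf _ cvgf] : [/\ mu.-integrable setT (EFin \o f),
  [sequence \int[mu]_x `|(EFin \o f_ n) x - (EFin \o f) x| ]_n @ \oo --> 0 &
  [sequence \int[mu]_x (EFin \o f_ n) x]_n @ \oo -->
    \int[mu]_x (EFin \o f) x]%E.
  apply: (@dominated_convergence _ _ _ mu setT measurableT _ _ (EFin \o g)) => //.
  - by move=> n; apply/measurable_EFinP.
  - apply/measurable_EFinP; apply: (measurable_fun_cvg mf_) => x _.
    exact: f_f.
  - by apply: aeW => x _; apply: cvg_EFin; [exact: nearW|exact: f_f].
  - by apply: aeW => x n _ /=; rewrite lee_fin.
split=> //; apply: fine_cvg; rewrite /Rintegral fineK//.
exact: integrable_fin_num.
Qed.

(** Since [n^n / n! <= e^n], the terms of the exponential series of [c V] have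
    expectations dominated by a geometric sequence of ratio [c e^b]; the choice
    [c = e^(-b) / 2] makes the ratio [1/2]. *)
Lemma integrable_expR_of_moments (d : measure_display) (T : measurableType d)
    (R : realType) (P : probability T R) (V : T -> R) (C b : R) :
  measurable_fun setT V -> (forall x, 0 <= V x) -> 0 <= b ->
  (forall n, \int[P]_x (V x ^+ n)%:E <= (C * (b * n%:R) ^+ n)%:E)%E ->
  exists2 c : R, 0 < c & P.-integrable setT (EFin \o (fun x => expR (c * V x))).
Proof.
move=> mV V0 b0 hV; pose c := expR (- b) / 2.
have c0 : 0 < c by rewrite divr_gt0// expR_gt0.
have C0 : 0 <= C.
  have := hV 0%N; rewrite expr0 mulr1; under eq_integral do rewrite expr0.
  rewrite integral_cst//= probability_setT mule1 lee_fin => h.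
  exact: le_trans h.
have mexp a : measurable_fun setT (fun x => expR (a * V x)).
  by apply: measurableT_comp => //; exact: measurable_funM.
exists c => //; apply/integrableP; split; first exact/measurable_EFinP.
have -> : (\int[P]_x `|(EFin \o (fun x => expR (c * V x))) x| =
    \int[P]_x \sum_(0 <= n <oo) (exp_coeff (c * V x) n)%:E)%E.
  apply: eq_integral => x _ /=; rewrite ger0_norm ?expR_ge0//.
  rewrite /expR -EFin_lim; last exact: is_cvg_series_exp_coeff.
  by apply: congr_lim; apply/funext => n /=; rewrite /series/= sumEFin.
rewrite integral_nneseries//; last 2 first.
- move=> n; apply/measurable_EFinP; rewrite /exp_coeff /=.
  apply: measurable_funM => //; apply: measurable_funX.
  exact: measurable_funM.
- by move=> n x _; rewrite lee_fin exp_coeff_ge0// mulr_ge0// ltW.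
have hle n : (\int[P]_x (exp_coeff (c * V x) n)%:E <= (geometric C 2^-1 n)%:E)%E.
  have -> : (\int[P]_x (exp_coeff (c * V x) n)%:E =
      (c ^+ n / n`!%:R)%:E * \int[P]_x (V x ^+ n)%:E)%E.
    rewrite -ge0_integralZl_EFin//.
    - by apply: eq_integral => x _; rewrite -EFinM /exp_coeff/= exprMn mulrAC.
    - by move=> x _; rewrite lee_fin exprn_ge0.
    - by apply/measurable_EFinP; exact: measurable_funX.
    - by rewrite divr_ge0// exprn_ge0// ltW.
  apply: (@le_trans _ _ ((c ^+ n / n`!%:R)%:E * (C * (b * n%:R) ^+ n)%:E)%E).
    rewrite lee_pmul2l//; have ? : 0 < c ^+ n / n`!%:R.
      by apply: divr_gt0; [exact: exprn_gt0|rewrite ltr0n fact_gt0].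
    by [].
  rewrite -EFinM lee_fin /= mulrCA; apply: ler_wpM2l => //.
  have hb : (b * n%:R) ^+ n / n`!%:R <= expR (b * n%:R).
    case: n => [|n]; first by rewrite expr0 fact0 mulr0 expR0 divr1.
    have h0 : 0 <= b * n.+1%:R by rewrite mulr_ge0.
    by apply: le_trans (expR_ge1Dxn n h0); rewrite lerDr.
  rewrite mulrAC -mulrA; apply: (@le_trans _ _ (c ^+ n * expR (b * n%:R))).
    by apply: ler_wpM2l => //; rewrite exprn_ge0// ltW.
  rewrite expRM_natr -exprMn.
  by rewrite /c mulrAC -expRD addNr expR0 div1r.
apply: (@le_lt_trans _ _ (\sum_(0 <= n <oo) (geometric C 2^-1 n)%:E)%E).
  apply: lee_nneseries => // n _ _; apply: integral_ge0 => x _.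
  by rewrite lee_fin exp_coeff_ge0// mulr_ge0// ltW.
have hg : cvgn (series (geometric C (2^-1 : R))).
  by apply: is_cvg_geometric_series; rewrite ger0_norm; lra.
rewrite (_ : (\sum_(0 <= n <oo) _)%E = (limn (series (geometric C (2^-1 : R))))%:E).
  exact: ltry.
rewrite -EFin_lim//; apply: congr_lim; apply/funext => n /=.
by rewrite /series/= sumEFin.
Qed.

(** Passing from a bound on [V^2] to one on [V]: the inequality
    [V <= V^2 / (2B) + B / 2] replaces Cauchy-Schwarz, with the advantage that
    the integrability of [V] need not be known beforehand. *)
Lemma integral_root_le (d : measure_display) (T : measurableType d)
    (R : realType) (P : probability T R) (V : T -> R) (C B : R) :
  measurable_fun setT V -> (forall x, 0 <= V x) -> 0 < B ->
  (\int[P]_x (V x ^+ 2)%:E <= (C * B ^+ 2)%:E)%E ->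
  (\int[P]_x (V x)%:E <= ((C + 1) / 2 * B)%:E)%E.
Proof.
move=> mV V0 B0 hV.
have B2 : 0 <= (2 * B)^-1 by rewrite invr_ge0 mulr_ge0// ltW.
have mV2 : measurable_fun setT (fun x => V x ^+ 2) by exact: measurable_funX.
apply: (@le_trans _ _ (\int[P]_x (((2 * B)^-1)%:E * (V x ^+ 2)%:E + (B / 2)%:E))%E).
  apply: ge0_le_integral => //.
  - by move=> x _; rewrite lee_fin.
  - exact/measurable_EFinP.
  - apply: emeasurable_funD; last exact: measurable_cst.
    by apply: emeasurable_funM => //; apply/measurable_EFinP.
  move=> x _; rewrite -EFinM -EFinD lee_fin.
  rewrite -(ler_pM2l (x := 2 * B)); last by lra.
  rewrite mulrDr mulrA divff ?mul1r; last by lra.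
  by have := sqr_ge0 (V x - B); nra.
rewrite ge0_integralD//=; last 3 first.
- by move=> x _; rewrite -EFinM lee_fin mulr_ge0 ?sqr_ge0.
- by apply: emeasurable_funM => //; apply/measurable_EFinP.
- by move=> x _; rewrite lee_fin divr_ge0// ltW.
rewrite ge0_integralZl_EFin//; last 2 first.
- by move=> x _; rewrite lee_fin sqr_ge0.
- exact/measurable_EFinP.
rewrite integral_cst//= probability_setT mule1.
apply: (@le_trans _ _ (((2 * B)^-1)%:E * (C * B ^+ 2)%:E + (B / 2)%:E)%E).
  by rewrite leeD2r// lee_pmul2l// lte_fin invr_gt0; lra.
rewrite -EFinM -EFinD lee_fin le_eqVlt; apply/orP; left; apply/eqP.
by field; lra.
Qed.

(** * Taylor expansion of the kernels *)

(** The right-hand sides are the coefficients used in the definitions of the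
    power series of [cos] and [sin]. *)
Lemma cos_sin_mul_pihalf (R : realType) (i : nat) :
  cos (i%:R * (pi / 2)) = (~~ odd i)%:R * (-1) ^+ i./2 :> R /\
  sin (i%:R * (pi / 2)) = (odd i)%:R * (-1) ^+ i.-1./2 :> R.
Proof.
elim: i => [|i [IHc IHs]]; first by rewrite mul0r cos0 sin0 /= mul0r mulr1.
rewrite -natr1 mulrDl mul1r cosDpihalf sinDpihalf IHc IHs /=; split=> //.
rewrite negbK; case: i {IHc IHs} => [|i] /=; first by rewrite !mul0r oppr0.
by rewrite exprS mulN1r mulrN.
Qed.

Lemma cvg_cos_taylor (R : realType) (a b : R) :
  series (fun i => cos (a + i%:R * (pi / 2)) * (b ^+ i / i`!%:R)) n @[n --> \oo]
    --> cos (a + b).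
Proof.
have -> : series (fun i => cos (a + i%:R * (pi / 2)) * (b ^+ i / i`!%:R)) =
  (fun n => cos a * series (cos_coeff b) n - sin a * series (sin_coeff b) n).
  apply/funext => n; rewrite /series/= !mulr_sumr -sumrB.
  apply: eq_bigr => i _; rewrite cosD.
  have [-> ->] := cos_sin_mul_pihalf R i.
  by rewrite /cos_coeff /sin_coeff /= -!exprnP; ring.
rewrite cosD; apply: cvgB; apply: cvgMr.
  by rewrite unlock; exact: is_cvg_series_cos_coeff.
by rewrite unlock; exact: is_cvg_series_sin_coeff.
Qed.

(** The [j]-th derivative of [cos]. *)
Definition cosn (R : realType) (j : nat) (u : R) : R := cos (u + j%:R * (pi / 2)).

(** The [j]-th derivative of [cosh]. *)
Definition coshn (R : realType) (j : nat) (u : R) : R :=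
  (expR u + (-1) ^+ j * expR (- u)) / 2.

(** [cos_kernel j] and [cosh_kernel j] are the restrictions to the two half-lines
    of the [j]-th derivative in [t] of [cos (t sqrt x)], an entire function of
    [x].  They are kept apart because the first one is bounded by a power of
    [sqrt x] uniformly in [t] whereas the second one is nonnegative: each
    property gives its own way of integrating the Taylor series term by term. *)
Definition cos_kernel (R : realType) (j : nat) (t x : R) : R :=
  if 0 <= x then Num.sqrt x ^+ j * cosn j (t * Num.sqrt x) else 0.

Definition cosh_kernel (R : realType) (j : nat) (t x : R) : R :=
  if x < 0 then Num.sqrt (- x) ^+ j * coshn j (t * Num.sqrt (- x)) else 0.

Lemma cvg_cosh_taylor (R : realType) (j : nat) (a b : R) :
  series (fun i => coshn (i + j) a * (b ^+ i / i`!%:R)) n @[n --> \oo]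
    --> coshn j (a + b).
Proof.
have -> : series (fun i => coshn (i + j) a * (b ^+ i / i`!%:R)) =
  (fun n => expR a / 2 * series (exp_coeff b) n +
            (-1) ^+ j * expR (- a) / 2 * series (exp_coeff (- b)) n).
  apply/funext => n; rewrite /series/= !mulr_sumr -big_split/=.
  apply: eq_bigr => i _; rewrite /coshn /exp_coeff/= exprD [(- b) ^+ i]exprNn.
  by ring.
have -> : coshn j (a + b) = expR a / 2 * expR b +
   (-1) ^+ j * expR (- a) / 2 * expR (- b).
  by rewrite /coshn opprD !expRD; ring.
by apply: cvgD; apply: cvgMr; exact: is_cvg_series_exp_coeff.
Qed.

Lemma cvg_cos_kernel (R : realType) (j : nat) (t s x : R) :
  series (fun i => s ^+ i / i`!%:R * cos_kernel (i + j) t x) n @[n --> \oo]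
    --> cos_kernel j (t + s) x.
Proof.
rewrite /cos_kernel; case: ifPn => x0; last first.
  rewrite (_ : series _ = cst 0); first exact: cvg_cst.
  by apply/funext => n; rewrite /series/= big1// => i _; rewrite mulr0.
have -> : series (fun i => s ^+ i / i`!%:R *
      (Num.sqrt x ^+ (i + j) * cosn (i + j) (t * Num.sqrt x))) =
   (fun n => Num.sqrt x ^+ j * series (fun i =>
      cos ((t * Num.sqrt x + j%:R * (pi / 2)) + i%:R * (pi / 2)) *
      ((s * Num.sqrt x) ^+ i / i`!%:R)) n).
  apply/funext => n; rewrite /series/= mulr_sumr; apply: eq_bigr => i _.
  rewrite /cosn natrD mulrDl -addrA [j%:R * _ + _]addrC exprD exprMn.
  by ring.
apply: cvgMr; rewrite /cosn (mulrDl t s) addrAC; exact: cvg_cos_taylor.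
Qed.

Lemma cvg_cosh_kernel (R : realType) (j : nat) (t s x : R) :
  series (fun i => s ^+ i / i`!%:R * cosh_kernel (i + j) t x) n @[n --> \oo]
    --> cosh_kernel j (t + s) x.
Proof.
rewrite /cosh_kernel; case: ifPn => x0; last first.
  rewrite (_ : series _ = cst 0); first exact: cvg_cst.
  by apply/funext => n; rewrite /series/= big1// => i _; rewrite mulr0.
have -> : series (fun i => s ^+ i / i`!%:R *
      (Num.sqrt (- x) ^+ (i + j) * coshn (i + j) (t * Num.sqrt (- x)))) =
   (fun n => Num.sqrt (- x) ^+ j * series (fun i =>
      coshn (i + j) (t * Num.sqrt (- x)) *
      ((s * Num.sqrt (- x)) ^+ i / i`!%:R)) n).
  apply/funext => n; rewrite /series/= mulr_sumr; apply: eq_bigr => i _.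
  by rewrite exprD exprMn; ring.
by apply: cvgMr; rewrite (mulrDl t s); exact: cvg_cosh_taylor.
Qed.

(** This sign is what makes Pringsheim's argument work: a Taylor series with
    nonnegative terms may be integrated without any prior domination. *)
Lemma cosh_kernel_ge0 (R : realType) (j : nat) (t x : R) :
  0 <= t -> 0 <= cosh_kernel j t x.
Proof.
move=> t0; rewrite /cosh_kernel; case: ifPn => // x0.
rewrite mulr_ge0 ?exprn_ge0// ?sqrtr_ge0// divr_ge0//.
have u0 : 0 <= t * Num.sqrt (- x) by rewrite mulr_ge0// sqrtr_ge0.
have le : expR (- (t * Num.sqrt (- x))) <= expR (t * Num.sqrt (- x)).
  by rewrite ler_expR; lra.
have e0 := expR_ge0 (t * Num.sqrt (- x)).
have e1 := expR_ge0 (- (t * Num.sqrt (- x))).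
by rewrite -signr_odd; case: (odd j); rewrite ?expr0 ?expr1; lra.
Qed.

Lemma cos_kernel_norm (R : realType) (j : nat) (t x : R) :
  `|cos_kernel j t x| <= Num.sqrt `|x| ^+ j.
Proof.
rewrite /cos_kernel; case: ifPn => x0; last by rewrite normr0 exprn_ge0// sqrtr_ge0.
rewrite (ger0_norm x0) normrM ger0_norm ?exprn_ge0 ?sqrtr_ge0//.
by rewrite ler_piMr ?exprn_ge0 ?sqrtr_ge0// cos_max.
Qed.

Lemma series_cos_kernel_norm (R : realType) (j : nat) (t s x : R) n :
  `|series (fun i => s ^+ i / i`!%:R * cos_kernel (i + j) t x) n| <=
  Num.sqrt `|x| ^+ j * expR (`|s| * Num.sqrt `|x|).
Proof.
apply: (@le_trans _ _ (Num.sqrt `|x| ^+ j *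
   series (exp_coeff (`|s| * Num.sqrt `|x|)) n)); last first.
  apply: ler_wpM2l; first by rewrite exprn_ge0 ?sqrtr_ge0.
  apply: nondecreasing_cvgn_le; last exact: is_cvg_series_exp_coeff.
  apply: nondecreasing_series => i _ _.
  by rewrite exp_coeff_ge0// mulr_ge0 ?sqrtr_ge0.
rewrite /series/= mulr_sumr; apply: le_trans (ler_norm_sum _ _ _) _.
apply: ler_sum => i _; rewrite normrM normrM normrX normfV normr_nat.
apply: le_trans (ler_wpM2l _ (cos_kernel_norm _ _ _)) _.
  by rewrite divr_ge0 ?exprn_ge0.
by rewrite /exp_coeff /= exprMn exprD le_eqVlt; apply/orP; left; apply/eqP; ring.
Qed.

Lemma measurable_sqrt (R : realType) : measurable_fun setT (@Num.sqrt R).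
Proof. by apply: continuous_measurable_fun; exact: sqrt_continuous. Qed.

Lemma measurable_cos (R : realType) : measurable_fun setT (@cos R).
Proof. by apply: continuous_measurable_fun; exact: continuous_cos. Qed.

Lemma measurable_cos_kernel (R : realType) (j : nat) (t : R) :
  measurable_fun setT (cos_kernel j t).
Proof.
have ms : measurable_fun setT (fun x : R => Num.sqrt x) := @measurable_sqrt R.
have mts : measurable_fun setT (fun x : R => t * Num.sqrt x).
  exact: measurable_funM.
have mc : measurable_fun setT (@cosn R j).
  apply: (measurableT_comp (@measurable_cos R)).
  exact: measurable_funD.
apply: measurable_fun_ifT => //; first exact: measurable_fun_ler.
by apply: measurable_funM; [exact: measurable_funX|exact: measurableT_comp].
Qed.

Lemma measurable_cosh_kernel (R : realType) (j : nat) (t : R) :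
  measurable_fun setT (cosh_kernel j t).
Proof.
have ms : measurable_fun setT (fun x : R => Num.sqrt (- x)).
  by apply: measurableT_comp; [exact: measurable_sqrt|exact: oppr_measurable].
have mts : measurable_fun setT (fun x : R => t * Num.sqrt (- x)).
  exact: measurable_funM.
apply: measurable_fun_ifT => //; first exact: measurable_fun_ltr.
apply: measurable_funM; first exact: measurable_funX.
apply: measurable_funM => //; apply: measurable_funD; first exact: measurableT_comp.
apply: measurable_funM => //; apply: measurableT_comp => //.
exact: measurableT_comp.
Qed.

Lemma exprn_le_expR (R : realType) (e v : R) (j : nat) : 0 < e -> 0 <= v ->
  v ^+ j <= j`!%:R / e ^+ j * expR (e * v).
Proof.
move=> e0 v0; have ev0 : 0 <= e * v by rewrite mulr_ge0// ltW.
have f0 : 0 < j`!%:R :> R by rewrite ltr0n fact_gt0.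
have ej : 0 < e ^+ j by rewrite exprn_gt0.
rewrite mulrAC ler_pdivlMr// -exprMn (mulrC v) (mulrC _ (expR _)) -ler_pdivrMr//.
case: j {ej} f0 => [|j] f0.
  by rewrite expr0 fact0 divr1; apply: le_trans (expR_ge1Dx _); rewrite lerDl.
by apply: le_trans (expR_ge1Dxn j ev0); rewrite lerDr.
Qed.

(** * Integrating the Taylor series term by term *)

Section expR_sqrt_integrable.
Context (d : measure_display) (T : measurableType d) (R : realType).
Context (P : probability T R) (Z : T -> R) (c : R).
Hypothesis mZ : measurable_fun setT Z.
Hypothesis c0 : 0 < c.
Hypothesis Zexp : P.-integrable setT
  (EFin \o (fun x => expR (c * Num.sqrt `|Z x|))).

Lemma integrable_sqrt_exprn_expR (j : nat) (s : R) : s <= c / 2 ->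
  P.-integrable setT (EFin \o
    (fun x => Num.sqrt `|Z x| ^+ j * expR (s * Num.sqrt `|Z x|))).
Proof.
move=> sc; have c20 : 0 < c / 2 by rewrite divr_gt0.
have msZ : measurable_fun setT (fun x => Num.sqrt `|Z x|).
  apply: (measurableT_comp (@measurable_sqrt R)).
  exact: measurableT_comp.
pose K : R := j`!%:R / (c / 2) ^+ j.
have K0 : 0 <= K by rewrite divr_ge0// exprn_ge0// ltW.
apply: (@le_integrable _ _ _ P setT measurableT _
  (EFin \o (fun x => K * expR (c * Num.sqrt `|Z x|)))).
- apply/measurable_EFinP; apply: measurable_funM; first exact: measurable_funX.
  by apply: measurableT_comp => //; exact: measurable_funM.
- move=> x _ /=; rewrite lee_fin.
  move: (sqrtr_ge0 `|Z x|); move: (Num.sqrt `|Z x|) => v v0.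
  rewrite !ger0_norm ?(mulr_ge0 _ (expR_ge0 _)) ?exprn_ge0//.
  have -> : c * v = c / 2 * v + c / 2 * v by field.
  rewrite expRD mulrA; apply: ler_pM; rewrite ?exprn_ge0 ?expR_ge0//.
    exact: exprn_le_expR.
  by rewrite ler_expR ler_wpM2r.
- have := integrableZl measurableT K Zexp.
  by apply: eq_integrable => // x _ /=; rewrite EFinM.
Qed.

Lemma integrable_sqrt_exprn (j : nat) :
  P.-integrable setT (EFin \o (fun x => Num.sqrt `|Z x| ^+ j)).
Proof.
have h : 0 <= c / 2 by rewrite divr_ge0// ltW.
have := integrable_sqrt_exprn_expR j h; apply: eq_integrable => // x _ /=.
by rewrite mul0r expR0 mulr1.
Qed.

Lemma integrable_cos_kernel (j : nat) (t : R) :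
  P.-integrable setT (EFin \o (fun x => cos_kernel j t (Z x))).
Proof.
apply: le_integrable (integrable_sqrt_exprn j) => //.
  apply/measurable_EFinP; apply: measurableT_comp => //.
  exact: measurable_cos_kernel.
move=> x _ /=; rewrite lee_fin [leRHS]ger0_norm ?exprn_ge0 ?sqrtr_ge0//.
exact: cos_kernel_norm.
Qed.

(** The radius of convergence [c / 2] does not depend on [t]; the other half of
    [c] absorbs the power [j]. *)
Lemma series_Rintegral_cos_kernel (j : nat) (t s : R) : `|s| <= c / 2 ->
  series (fun i => s ^+ i / i`!%:R * \int[P]_(x in setT) cos_kernel (i + j) t (Z x)) n
    @[n --> \oo] --> \int[P]_(x in setT) cos_kernel j (t + s) (Z x).
Proof.
move=> sc.
have mk i : measurable_fun setT
    (fun x => s ^+ i / i`!%:R * cos_kernel (i + j) t (Z x)).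
  apply: measurable_funM => //; apply: measurableT_comp => //.
  exact: measurable_cos_kernel.
have ik i : P.-integrable setT
    (EFin \o (fun x => s ^+ i / i`!%:R * cos_kernel (i + j) t (Z x))).
  have := integrableZl measurableT (s ^+ i / i`!%:R) (integrable_cos_kernel (i + j) t).
  by apply: eq_integrable => // x _ /=; rewrite EFinM.
have mser n : measurable_fun setT
    (fun x => series (fun i => s ^+ i / i`!%:R * cos_kernel (i + j) t (Z x)) n).
  by rewrite /series/=; apply: measurable_sum.
have [_] := Rintegral_dominated_cvg mser (fun x => @cvg_cos_kernel R j t s (Z x))
  (integrable_sqrt_exprn_expR j sc)
  (fun n x => series_cos_kernel_norm j t s (Z x) n).
rewrite (_ : (fun n => \int[P]_(x in setT) _) = series (fun i => s ^+ i / i`!%:R *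
    \int[P]_(x in setT) cos_kernel (i + j) t (Z x)))//.
apply/funext; elim=> [|n IHn]; rewrite /series/=.
  rewrite big_nil (_ : (fun x => _) = cst 0) ?Rintegral_cst ?mul0r//.
  by apply/funext => x; rewrite big_nil.
rewrite big_nat_recr//= -[X in X + _]IHn -RintegralZl//; last exact: integrable_cos_kernel.
rewrite -RintegralD//.
- by apply: eq_Rintegral => x _; rewrite /series/= big_nat_recr.
- rewrite /series/= (_ : EFin \o _ = (fun x => \sum_(i <- index_iota 0 n)
    (s ^+ i / i`!%:R * cos_kernel (i + j) t (Z x))%:E)%E).
    by apply: integrable_sum => // i _; exact: ik.
  by apply/funext => x /=; rewrite sumEFin.
Qed.

(** The integrability at [t + s] is part of the conclusion: by Tonelli's theorem
    it follows from the convergence of the series of the integrals at [t]. *)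
Lemma Rintegral_cosh_kernelD (j : nat) (t s l : R) : 0 <= t -> 0 <= s ->
  (forall i, P.-integrable setT (EFin \o (fun x => cosh_kernel i t (Z x)))) ->
  series (fun i => s ^+ i / i`!%:R * \int[P]_(x in setT) cosh_kernel (i + j) t (Z x)) n
    @[n --> \oo] --> l ->
  P.-integrable setT (EFin \o (fun x => cosh_kernel j (t + s) (Z x))) /\
  \int[P]_(x in setT) cosh_kernel j (t + s) (Z x) = l.
Proof.
move=> t0 s0 ik hl.
have mk i u : measurable_fun setT (fun x => cosh_kernel i u (Z x)).
  by apply: measurableT_comp => //; exact: measurable_cosh_kernel.
have hI : (\int[P]_x (cosh_kernel j (t + s) (Z x))%:E = l%:E)%E.
  transitivity (\int[P]_x \sum_(0 <= i <oo)
      (s ^+ i / i`!%:R * cosh_kernel (i + j) t (Z x))%:E)%E.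
    apply: eq_integral => x _; have hx := @cvg_cosh_kernel R j t s (Z x).
    rewrite -(cvg_lim _ hx)// -EFin_lim; last by apply/cvg_ex; eexists; exact: hx.
    by apply: congr_lim; apply/funext => n /=; rewrite /series/= sumEFin.
  rewrite integral_nneseries//; last 2 first.
  - by move=> n; apply/measurable_EFinP; exact: measurable_funM.
  - by move=> n x _; rewrite lee_fin mulr_ge0 ?cosh_kernel_ge0// divr_ge0 ?exprn_ge0.
  rewrite -(cvg_lim _ hl)// -EFin_lim; last by apply/cvg_ex; eexists; exact: hl.
  apply: congr_lim; apply/funext => n /=; rewrite /series/= -sumEFin.
  apply: eq_bigr => i _; rewrite EFinM /Rintegral fineK; last first.
    by apply: integrable_fin_num => //; exact: ik.
  rewrite -ge0_integralZl_EFin//.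
  - by move=> x _; rewrite lee_fin cosh_kernel_ge0.
  - by apply/measurable_EFinP.
  - by rewrite divr_ge0 ?exprn_ge0.
split; last by rewrite /Rintegral hI.
apply/integrableP; split; first by apply/measurable_EFinP.
under eq_integral do rewrite /= ger0_norm ?cosh_kernel_ge0 ?addr_ge0//.
by rewrite hI ltry.
Qed.

End expR_sqrt_integrable.

(** * Laws with equal moments *)

Section equal_moments.
Context (d d' : measure_display) (T : measurableType d) (T' : measurableType d').
Context (R : realType) (P : probability T R) (Q : probability T' R).
Context (X : T -> R) (Y : T' -> R) (c : R).
Hypotheses (mX : measurable_fun setT X) (mY : measurable_fun setT Y).
Hypothesis X0 : forall x, 0 <= X x.
Hypothesis c0 : 0 < c.
Hypothesis Xexp : P.-integrable setT
  (EFin \o (fun x => expR (c * Num.sqrt `|X x|))).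
Hypothesis Yexp : Q.-integrable setT
  (EFin \o (fun y => expR (c * Num.sqrt `|Y y|))).
Hypothesis XY : forall k : nat,
  \int[P]_(x in setT) (X x ^+ k) = \int[Q]_(y in setT) (Y y ^+ k).

(** The expectations of [cos (t sqrt X)] and [cos (t sqrt Y)] agree together
    with all their derivatives in [t]; the finiteness of the contribution of
    [Y < 0] is part of what has to be propagated in [t]. *)
Let kernel_identity (t : R) : Prop :=
  (forall j, Q.-integrable setT (EFin \o (fun y => cosh_kernel j t (Y y)))) /\
  (forall j, \int[P]_(x in setT) cos_kernel j t (X x) =
     \int[Q]_(y in setT) cos_kernel j t (Y y) +
     \int[Q]_(y in setT) cosh_kernel j t (Y y)).

Let cosn0 (k : nat) : cosn k 0 = (~~ odd k)%:R * (-1) ^+ k./2 :> R.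
Proof. by rewrite /cosn add0r (cos_sin_mul_pihalf R k).1. Qed.

Let coshn0 (k : nat) : coshn k 0 = (~~ odd k)%:R :> R.
Proof.
rewrite /coshn oppr0 expR0 mulr1 -signr_odd; case: (odd k) => /=.
  by rewrite expr1 subrr mul0r.
by rewrite expr0 -mulr2n -[X in X / _]mulr_natr mul1r divff.
Qed.

Let sqrt_even (k : nat) (y : R) : ~~ odd k -> 0 <= y ->
  Num.sqrt y ^+ k = y ^+ k./2.
Proof.
move=> ek y0; rewrite -[in LHS](odd_double_half k) (negbTE ek) add0n.
by rewrite -muln2 mulnC exprM sqr_sqrtr.
Qed.

(** At [t = 0] the odd derivatives vanish: no half-integer power of [x] is left,
    and only the moments shared by [X] and [Y] enter. *)
Let kernel_sum0 (j : nat) (y : R) :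
  cos_kernel j 0 y + cosh_kernel j 0 y = (~~ odd j)%:R * (-1) ^+ j./2 * y ^+ j./2.
Proof.
rewrite /cos_kernel /cosh_kernel !mul0r cosn0 coshn0.
have [oj|ej] := boolP (odd j); first by rewrite !mul0r !mulr0 !if_same addr0.
rewrite !mul1r mulr1 leNgt; case: ltP => y0 /=.
  by rewrite add0r sqrt_even// ?oppr_ge0 ?ltW// -exprMn mulN1r.
by rewrite addr0 sqrt_even// mulrC.
Qed.

Let kernel_identity0 : kernel_identity 0.
Proof.
have mk j : measurable_fun setT (fun x => cosh_kernel j 0 (Y x)).
  by apply: measurableT_comp => //; exact: measurable_cosh_kernel.
have ik j : Q.-integrable setT (EFin \o (fun y => cosh_kernel j 0 (Y y))).
  have h := integrable_sqrt_exprn mY c0 Yexp j.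
  apply: le_integrable h => //; first exact/measurable_EFinP.
  move=> y _ /=; rewrite lee_fin [leRHS]ger0_norm ?exprn_ge0 ?sqrtr_ge0//.
  rewrite ger0_norm ?cosh_kernel_ge0//.
  rewrite /cosh_kernel; case: ifPn => y0; last by rewrite exprn_ge0 ?sqrtr_ge0.
  rewrite mul0r coshn0 ltr0_norm//.
  by case: (odd j); rewrite ?mulr0 ?mulr1 ?exprn_ge0 ?sqrtr_ge0.
have aux (d1 : measure_display) (T1 : measurableType d1) (P1 : probability T1 R)
    (Z : T1 -> R) (mZ : measurable_fun setT Z) (Zexp : P1.-integrable setT
      (EFin \o (fun x => expR (c * Num.sqrt `|Z x|)))) j :
    \int[P1]_(x in setT) ((~~ odd j)%:R * (-1) ^+ j./2 * Z x ^+ j./2) =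
    (~~ odd j)%:R * (-1) ^+ j./2 * \int[P1]_(x in setT) (Z x ^+ j./2).
  rewrite -RintegralZl//.
  have h := integrable_sqrt_exprn mZ c0 Zexp (j./2 * 2).
  apply: le_integrable h => //.
    by apply/measurable_EFinP; exact: measurable_funX.
  move=> x _ /=; rewrite lee_fin mulnC exprM sqr_sqrtr// normrX.
  by rewrite [leRHS]ger0_norm ?exprn_ge0.
split=> // j; rewrite -RintegralD//; last exact: integrable_cos_kernel Yexp _ _.
under [in RHS]eq_Rintegral do rewrite kernel_sum0.
rewrite aux// -XY -aux//; apply: eq_Rintegral => x _.
by rewrite -kernel_sum0 /cosh_kernel ltNge X0 addr0.
Qed.

(** The series of the integrals over [Y < 0] is the difference of the other two
    series, both of which converge because they involve only the bounded
    kernel. *)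
Let kernel_identityD (t s : R) : 0 <= t -> 0 <= s <= c / 2 ->
  kernel_identity t -> kernel_identity (t + s).
Proof.
move=> t0 /andP[s0 sc] [ik idk].
have sc' : `|s| <= c / 2 by rewrite ger0_norm.
have key j := Rintegral_cosh_kernelD mY t0 s0 ik (j := j)
  (l := \int[P]_(x in setT) cos_kernel j (t + s) (X x) -
        \int[Q]_(y in setT) cos_kernel j (t + s) (Y y)) _.
have hs j : series (fun i => s ^+ i / i`!%:R *
    \int[Q]_(y in setT) cosh_kernel (i + j) t (Y y)) n @[n --> \oo] -->
    \int[P]_(x in setT) cos_kernel j (t + s) (X x) -
    \int[Q]_(y in setT) cos_kernel j (t + s) (Y y).
  have hX := @series_Rintegral_cos_kernel _ _ _ P X c mX c0 Xexp j t s sc'.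
  have hY := @series_Rintegral_cos_kernel _ _ _ Q Y c mY c0 Yexp j t s sc'.
  rewrite (_ : series _ = (fun n => series (fun i => s ^+ i / i`!%:R *
       \int[P]_(x in setT) cos_kernel (i + j) t (X x)) n -
     series (fun i => s ^+ i / i`!%:R *
       \int[Q]_(y in setT) cos_kernel (i + j) t (Y y)) n)); first exact: cvgB hX hY.
  apply/funext => n; rewrite /series/= -sumrB; apply: eq_bigr => i _.
  by rewrite idk -mulrBr addrAC subrr add0r.
by split=> j; have [// ij e] := key hs j; rewrite e [RHS]addrC subrK.
Qed.

Lemma kernel_identity_all (t : R) : 0 <= t -> kernel_identity t.
Proof.
move=> t0; have c2 : 0 < c / 2 by rewrite divr_gt0.
pose N := (Num.truncn (t / (c / 2))).+1.
have N0 : 0 < N%:R :> R by rewrite ltr0n.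
have hN : t / N%:R <= c / 2.
  rewrite ler_pdivrMr// mulrC -ler_pdivrMr// ltW//.
  by rewrite /N truncnS_gt.
have h n : kernel_identity (n%:R * (t / N%:R)).
  elim: n => [|n IHn]; first by rewrite mul0r.
  rewrite -natr1 mulrDl mul1r; apply: kernel_identityD => //.
    by rewrite mulr_ge0// divr_ge0.
  by rewrite divr_ge0//= ?hN.
by have := h N; rewrite mulrCA divff ?mulr1// gt_eqF.
Qed.

(** The integral of [cosh (t sqrt (- Y))] over [Y < 0] is the difference of two
    numbers of absolute value at most [1]; as [cosh u >= u / 2], the expectation
    of [sqrt (- Y)] (zero where [Y >= 0]) is at most [4 / t] for every [t]. *)
Lemma ae_nonneg : (\forall y \ae Q, 0 <= Y y).
Proof.
have iG : Q.-integrable setT (EFin \o (fun y => Num.sqrt (- Y y))).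
  have h := integrable_sqrt_exprn mY c0 Yexp 1.
  apply: le_integrable h => //.
    apply/measurable_EFinP; apply: (measurableT_comp (@measurable_sqrt R)).
    exact: measurable_funN.
  move=> y _ /=; rewrite lee_fin expr1 [leLHS]ger0_norm ?[leRHS]ger0_norm ?sqrtr_ge0//.
  by rewrite ler_wsqrtr// -normrN ler_norm.
have G0 : 0 <= \int[Q]_(y in setT) Num.sqrt (- Y y).
  by apply: Rintegral_ge0 => y _; exact: sqrtr_ge0.
have bound (d1 : measure_display) (T1 : measurableType d1) (P1 : probability T1 R)
    (Z : T1 -> R) (mZ : measurable_fun setT Z) (Zexp : P1.-integrable setT
      (EFin \o (fun x => expR (c * Num.sqrt `|Z x|)))) t :
    `|\int[P1]_(x in setT) cos_kernel 0 t (Z x)| <= 1.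
  have ik := integrable_cos_kernel mZ c0 Zexp 0 t.
  apply: le_trans (le_normr_Rintegral measurableT ik) _.
  apply: (@le_trans _ _ (\int[P1]_(x in setT) 1)); last first.
    by rewrite Rintegral_cst//= probability_setT mul1r.
  apply: le_Rintegral => //.
  - exact: integrable_norm ik.
  - exact: finite_measure_integrable_cst.
  - by move=> x _; apply: le_trans (cos_kernel_norm _ _ _) _; rewrite expr0.
have le4 t : 0 <= t -> t * \int[Q]_(y in setT) Num.sqrt (- Y y) <= 4.
  move=> t0; have [ik idk] := kernel_identity_all t0.
  have h : \int[Q]_(y in setT) cosh_kernel 0 t (Y y) <= 2.
    have := bound _ _ _ _ mX Xexp t; have := bound _ _ _ _ mY Yexp t.
    by rewrite idk !ler_norml => /andP[? ?] /andP[? ?]; lra.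
  apply: (@le_trans _ _ (2 * \int[Q]_(y in setT) cosh_kernel 0 t (Y y))); last by lra.
  rewrite -!RintegralZl//; apply: le_Rintegral => //.
  - by have := integrableZl measurableT t iG; apply: eq_integrable => // y _ /=; rewrite EFinM.
  - by have := integrableZl measurableT 2 (ik 0%N); apply: eq_integrable => // y _ /=; rewrite EFinM.
  move=> y _; rewrite /cosh_kernel; case: ltP => y0; last first.
    by rewrite ler0_sqrtr ?mulr0// oppr_le0.
  rewrite /coshn !expr0 !mul1r.
  have := expR_ge1Dx (t * Num.sqrt (- Y y)).
  have := expR_ge0 (- (t * Num.sqrt (- Y y))).
  by lra.
have I0 : \int[Q]_(y in setT) Num.sqrt (- Y y) = 0.
  apply/eqP; rewrite eq_le G0 andbT leNgt; apply/negP => Gp.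
  have := le4 (5 / \int[Q]_(y in setT) Num.sqrt (- Y y)).
  by rewrite divfK ?gt_eqF// divr_ge0//; lra.
have /integrableP [mG _] := iG.
have : ae_eq Q setT (EFin \o (fun y => Num.sqrt (- Y y))) (cst 0%E).
  apply/ae_eq_integral_abs => //.
  transitivity (\int[Q]_y (EFin \o (fun y => Num.sqrt (- Y y))) y)%E.
    by apply: eq_integral => y _ /=; rewrite ger0_norm ?sqrtr_ge0.
  by rewrite -[LHS]fineK ?integrable_fin_num//; congr EFin.
apply: filterS => y /(_ I) /= [] /eqP; rewrite sqrtr_eq0 oppr_le0.
by [].
Qed.

Lemma Rintegral_cos_sqrt_eq (t : R) : 0 <= t ->
  \int[P]_(x in setT) cos (t * Num.sqrt (X x)) =
  \int[Q]_(y in setT) cos (t * Num.sqrt (Y y)).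
Proof.
move=> t0; have [ik idk] := kernel_identity_all t0.
transitivity (\int[P]_(x in setT) cos_kernel 0 t (X x)).
  apply: eq_Rintegral => x _.
  by rewrite /cos_kernel X0 expr0 mul1r /cosn mul0r addr0.
rewrite idk -RintegralD//; last exact: integrable_cos_kernel Yexp _ _.
rewrite /Rintegral; congr fine; apply: ae_eq_integral => //.
- apply/measurable_EFinP; apply: measurable_funD.
    by apply: measurableT_comp => //; exact: measurable_cos_kernel.
  by apply: measurableT_comp => //; exact: measurable_cosh_kernel.
- apply/measurable_EFinP; apply: (measurableT_comp (@measurable_cos R)).
  apply: measurable_funM => //; exact: (measurableT_comp (@measurable_sqrt R)).
apply: filterS ae_nonneg => y y0 _; congr EFin.
rewrite /cos_kernel /cosh_kernel y0 ltNge y0/= addr0.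
by rewrite expr0 mul1r /cosn mul0r addr0.
Qed.

End equal_moments.

(** * Cosine transforms determine a nonnegative law *)

Lemma cvg_natrM_exprn (R : realType) (q : R) : 0 <= q < 1 ->
  n%:R * q ^+ n @[n --> \oo] --> 0.
Proof.
(* a square root of [q] would do; the arithmetic mean with [1] is larger and
   avoids the case [q = 0] *)
move=> /andP[q0 q1]; pose r := (1 + q) / 2.
have r0 : 0 < r by rewrite /r; lra.
have r1 : r < 1 by rewrite /r; lra.
have nr1 : `|r| < 1 by rewrite gtr0_norm.
have qr : q <= r ^+ 2 by rewrite /r; have := sqr_ge0 (1 - q); nra.
apply: (@squeeze_cvgr _ _ _ _ (cst 0) (geometric (1 / (1 - r)) r)); last 2 first.
- exact: cvg_cst.
- exact: cvg_geometric.
near=> n; rewrite mulr_ge0 ?exprn_ge0//=.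
apply: (@le_trans _ _ (n%:R * r ^+ n * r ^+ n)).
  rewrite -mulrA ler_wpM2l// -exprMn -expr2.
  by rewrite lerXn2r ?nnegrE// sqr_ge0.
apply: ler_wpM2r; first by rewrite exprn_ge0 ?(ltW r0).
apply: le_trans (geometric_le_lim n (@ler01 R) r0 nr1).
(* [n r^n] is at most the sum of the first [n] powers of [r] *)
rewrite /series/= mulr_natl -[X in _ *+ X](subn0 n) -sumr_const_nat.
apply: ler_sum_nat => i /andP[_ ilt].
by rewrite mul1r; apply: ler_wiXn2l; [exact: ltW|exact: ltW|exact: ltnW].
Unshelve. all: by end_near. Qed.

(** The Brosowski-Deutsch polynomials: [(1 - z^n)^M] is close to [1] when
    [M z^n] is small (Bernoulli) and to [0] when [M z^n] is large
    ([1 - u <= exp (- u)]).  The factor [n] in the exponent [M = n 2^n] makes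
    the limit [0] also at the threshold [z = 1/2]. *)
Lemma cvg_threshold (R : realType) (z : R) : 0 <= z <= 1 ->
  (1 - z ^+ n) ^+ (n * 2 ^ n) @[n --> \oo] --> (if z < 1 / 2 then 1 else 0 : R).
Proof.
move=> /andP[z0 z1].
have zn0 n : 0 <= z ^+ n by rewrite exprn_ge0.
have zn1 n : 0 <= 1 - z ^+ n by rewrite subr_ge0 exprn_ile1.
have E n : (n * 2 ^ n)%:R * z ^+ n = n%:R * (2 * z) ^+ n :> R.
  by rewrite natrM natrX exprMn mulrA.
case: ifPn => [zlt|]; last rewrite -leNgt => zge.
  have h : 1 - n%:R * (2 * z) ^+ n @[n --> \oo] --> (1 - 0 : R).
    apply: cvgB; first exact: cvg_cst.
    by apply: cvg_natrM_exprn; lra.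
  rewrite subr0 in h.
  apply: (@squeeze_cvgr _ _ _ _ (fun n => 1 - n%:R * (2 * z) ^+ n) (cst 1)) => //.
  - near=> n; rewrite exprn_ile1 ?andbT//; last by rewrite lerBlDr lerDl.
    rewrite -E; elim: (n * 2 ^ n)%N => [|m IHm].
      by rewrite mul0r subr0 expr0.
    rewrite exprSr -natr1.
    apply: le_trans (ler_wpM2r (zn1 n) IHm).
    have := zn0 n; have : 0 <= m%:R :> R by []; nra.
  - exact: cvg_cst.
have h : geometric 1 (expR (-1)) n @[n --> \oo] --> (0 : R).
  by apply: cvg_geometric; rewrite ger0_norm ?expR_ge0// expR_lt1; lra.
apply: (@squeeze_cvgr _ _ _ _ (cst 0) (geometric 1 (expR (-1)))) => //; last first.
  exact: cvg_cst.
near=> n; rewrite exprn_ge0//= mul1r.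
apply: (@le_trans _ _ (expR (- z ^+ n) ^+ (n * 2 ^ n))).
  rewrite lerXn2r ?nnegrE ?expR_ge0//.
  by apply: le_trans (expR_ge1Dx _).
rewrite -!expRM_natl ler_expR mulrN E mulrN1 lerN2 ler_peMr//.
by rewrite exprn_ege1//; lra.
Unshelve. all: by end_near. Qed.

Section cosine_transform.
Context (d d' : measure_display) (T : measurableType d) (T' : measurableType d').
Context (R : realType) (P : probability T R) (Q : probability T' R).
Context (U : T -> R) (V : T' -> R).
Hypotheses (mU : measurable_fun setT U) (mV : measurable_fun setT V).
Hypotheses (U0 : forall x, 0 <= U x) (V0 : forall y, 0 <= V y).
Hypothesis UV : forall t : R, 0 <= t ->
  \int[P]_(x in setT) cos (t * U x) = \int[Q]_(y in setT) cos (t * V y).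

Let bounded_integrable (d1 : measure_display) (T1 : measurableType d1)
    (P1 : probability T1 R) (f : T1 -> R) (M : R) :
  measurable_fun setT f -> (forall x, `|f x| <= M) ->
  P1.-integrable setT (EFin \o f).
Proof.
move=> mf fM; apply: (@le_integrable _ _ _ P1 setT measurableT _ (EFin \o cst M)).
- exact/measurable_EFinP.
- by move=> x _ /=; rewrite lee_fin; apply: le_trans (fM x) _; exact: ler_norm.
- exact: finite_measure_integrable_cst.
Qed.

(** Asking for the identity after multiplication by every [cos (t u)] makes the
    class stable under multiplication by cosines, by the product-to-sum
    formula; hence it contains the polynomials in [cos (s u)]. *)
Let test (f : R -> R) : Prop :=
  [/\ measurable_fun setT f, exists M, forall x, `|f x| <= M &
   forall t, \int[P]_(x in setT) (f (U x) * cos (t * U x)) =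
             \int[Q]_(y in setT) (f (V y) * cos (t * V y))].

Let test_integrable (d1 : measure_display) (T1 : measurableType d1)
    (P1 : probability T1 R) (Z : T1 -> R) f t : measurable_fun setT Z -> test f ->
  P1.-integrable setT (EFin \o (fun x => f (Z x) * cos (t * Z x))).
Proof.
move=> mZ [mf [M fM] _].
apply: (@bounded_integrable _ _ _ _ M).
  apply: measurable_funM; first exact: measurableT_comp.
  by apply: (measurableT_comp (@measurable_cos R)); exact: measurable_funM.
move=> x; rewrite normrM -[leRHS]mulr1; apply: ler_pM => //; exact: cos_max.
Qed.

Let test1 : test (fun=> 1).
Proof.
split; first exact: measurable_cst.
  by exists 1 => x; rewrite normr1.
move=> t; have h (d1 : measure_display) (T1 : measurableType d1)
    (P1 : probability T1 R) (Z : T1 -> R) : (forall x, 0 <= Z x) ->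
    \int[P1]_(x in setT) (1 * cos (t * Z x)) = \int[P1]_(x in setT) cos (`|t| * Z x).
  by move=> Z0; apply: eq_Rintegral => x _; rewrite mul1r -cos_norm normrM (ger0_norm (Z0 x)).
by rewrite !h// UV.
Qed.

Let testD f g a b : test f -> test g -> test (fun x => a * f x + b * g x).
Proof.
move=> tf tg; have [mf [M fM] _] := tf; have [mg [N gN] _] := tg; split.
- by apply: measurable_funD; exact: measurable_funM.
- exists (`|a| * M + `|b| * N) => x; apply: le_trans (ler_normD _ _) _.
  by rewrite !normrM lerD// ler_wpM2l.
move=> t; have h (d1 : measure_display) (T1 : measurableType d1)
    (P1 : probability T1 R) (Z : T1 -> R) (mZ : measurable_fun setT Z) :
    \int[P1]_(x in setT) ((a * f (Z x) + b * g (Z x)) * cos (t * Z x)) =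
    a * \int[P1]_(x in setT) (f (Z x) * cos (t * Z x)) +
    b * \int[P1]_(x in setT) (g (Z x) * cos (t * Z x)).
  have If := test_integrable P1 t mZ tf; have Ig := test_integrable P1 t mZ tg.
  have zI (c : R) (k : T1 -> R) : P1.-integrable setT (EFin \o k) ->
      P1.-integrable setT (EFin \o (fun x => c * k x)).
    move=> Ik; have := integrableZl measurableT c Ik.
    by apply: eq_integrable => // x _ /=; rewrite EFinM.
  rewrite -!RintegralZl// -RintegralD; [|by []|exact: zI|exact: zI].
  by apply: eq_Rintegral => x _; rewrite mulrDl !mulrA.
by rewrite !h//; have [_ _ ->] := tf; have [_ _ ->] := tg.
Qed.

Let test_cos f s : test f -> test (fun x => f x * cos (s * x)).
Proof.
move=> tf; have [mf [M fM] tfE] := tf; split.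
- apply: measurable_funM => //; apply: (measurableT_comp (@measurable_cos R)).
  exact: measurable_funM.
- exists M => x; rewrite normrM -[leRHS]mulr1; apply: ler_pM => //; exact: cos_max.
move=> t; have h (d1 : measure_display) (T1 : measurableType d1)
    (P1 : probability T1 R) (Z : T1 -> R) (mZ : measurable_fun setT Z) :
    \int[P1]_(x in setT) (f (Z x) * cos (s * Z x) * cos (t * Z x)) =
    2^-1 * (\int[P1]_(x in setT) (f (Z x) * cos ((s + t) * Z x)) +
    \int[P1]_(x in setT) (f (Z x) * cos ((s - t) * Z x))).
  have I1 := test_integrable P1 (s + t) mZ tf.
  have I2 := test_integrable P1 (s - t) mZ tf.
  rewrite -RintegralD// -RintegralZl//; last first.
    have := integrableD measurableT I1 I2.
    by apply: eq_integrable => // x _ /=; rewrite EFinD.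
  apply: eq_Rintegral => x _; rewrite (mulrDl s t) (mulrBl (Z x) s t) cosD cosB; by field.
by rewrite !h// !tfE.
Qed.

Let test_mul f a b s : test f -> test (fun x => f x * (a + b * cos (s * x))).
Proof.
move=> tf; have := testD a b tf (test_cos s tf).
by congr test; apply/funext => x; ring.
Qed.

Let test_exp f a b s n : test f -> test (fun x => f x * (a + b * cos (s * x)) ^+ n).
Proof.
elim: n f => [|n IHn] f tf.
  by move: tf; congr test; apply/funext => x; rewrite expr0 mulr1.
have := IHn _ (test_mul a b s tf).
by congr test; apply/funext => x; rewrite exprS mulrA.
Qed.

Let test_threshold a b s n m : test (fun x => (1 - (a + b * cos (s * x)) ^+ n) ^+ m).
Proof.
suff h f : test f -> test (fun x => f x * (1 - (a + b * cos (s * x)) ^+ n) ^+ m).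
  by have := h _ test1; congr test; apply/funext => x; rewrite mul1r.
elim: m f => [|m IHm] f tf.
  by move: tf; congr test; apply/funext => x; rewrite expr0 mulr1.
have := IHm _ (testD 1 (-1) tf (test_exp a b s n tf)).
by congr test; apply/funext => x; rewrite exprS; ring.
Qed.

Let same_mean_lim (f_ : nat -> R -> R) (f : R -> R) :
  (forall n, measurable_fun setT (f_ n)) ->
  (forall n x, 0 <= x -> `|f_ n x| <= 1) ->
  (forall n, \int[P]_(x in setT) f_ n (U x) = \int[Q]_(y in setT) f_ n (V y)) ->
  (forall x, 0 <= x -> f_ n x @[n --> \oo] --> f x) ->
  \int[P]_(x in setT) f (U x) = \int[Q]_(y in setT) f (V y).
Proof.
move=> mf_ f1 e hl.
have h (d1 : measure_display) (T1 : measurableType d1)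
    (P1 : probability T1 R) (Z : T1 -> R) (mZ : measurable_fun setT Z) :
    (forall x, 0 <= Z x) ->
    \int[P1]_(x in setT) f_ n (Z x) @[n --> \oo] --> \int[P1]_(x in setT) f (Z x).
  move=> Z0; have [] := @Rintegral_dominated_cvg _ _ R P1 (fun n x => f_ n (Z x))
    (fun x => f (Z x)) (cst 1) => //.
  - by move=> n; exact: measurableT_comp.
  - by move=> x; exact: hl.
  - exact: finite_measure_integrable_cst.
  - by move=> n x; exact: f1.
have := h _ _ P _ mU U0; under eq_cvg do rewrite e.
by move=> /cvg_lim <- //; apply/esym; have /cvg_lim -> := h _ _ Q _ mV V0.
Qed.

(** The factor [l] is chosen so that [l (1 + cos (s u))] lies in [[0, 1]] and
    crosses [1/2] where [cos (s u)] crosses [cos (s a)]; the condition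
    [0 <= cos (s a)] is what keeps it below [1]. *)
Let same_mean_cos_lt (s a : R) : 0 <= cos (s * a) ->
  \int[P]_(x in setT) (cos (s * U x) < cos (s * a))%R%:R =
  \int[Q]_(y in setT) (cos (s * V y) < cos (s * a))%R%:R.
Proof.
move=> ca; pose l := (2 * (1 + cos (s * a)))^-1.
have ca1 := cos_le1 (s * a).
have l0 : 0 < l by rewrite /l invr_gt0; lra.
have lE : 2 * l * (1 + cos (s * a)) = 1 by rewrite /l; field; lra.
have l1 x : 0 <= l + l * cos (s * x) <= 1.
  by have := cos_le1 (s * x); have := cos_geN1 (s * x) => *; apply/andP; split; nra.
have lt x : (l + l * cos (s * x) < 1 / 2) = (cos (s * x) < cos (s * a)).
  by apply/idP/idP; nra.
apply: (same_mean_lim (f_ := fun n x => (1 - (l + l * cos (s * x)) ^+ n) ^+ (n * 2 ^ n))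
  (f := fun x => (cos (s * x) < cos (s * a))%R%:R : R)).
- by move=> n; have [] := test_threshold l l s n (n * 2 ^ n).
- move=> n x _; have /andP[z0 z1] := l1 x.
  have y0 : 0 <= (l + l * cos (s * x)) ^+ n by rewrite exprn_ge0.
  have y1 : (l + l * cos (s * x)) ^+ n <= 1 by rewrite exprn_ile1.
  by rewrite ger0_norm ?exprn_ge0 ?exprn_ile1//; lra.
- move=> n; have [_ _ /(_ 0)] := test_threshold l l s n (n * 2 ^ n).
  under eq_Rintegral do rewrite mul0r cos0 mulr1.
  by under [in RHS]eq_Rintegral do rewrite mul0r cos0 mulr1.
- move=> x _; have := cvg_threshold (l1 x).
  by rewrite lt; case: (_ < _).
Qed.

(** For a period much longer than [a] and [u], the cosine is decreasing on the
    relevant range, so [cos (s u) < cos (s a)] means [a < u] as [s] tends to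
    [0]. *)
Lemma tail_of_cosine_transform (a : R) : 0 <= a ->
  \int[P]_(x in setT) (a < U x)%R%:R = \int[Q]_(y in setT) (a < V y)%R%:R.
Proof.
move=> a0; pose N := (Num.truncn a).+1; pose s (k : nat) : R := (k + N)%:R^-1.
have s0 k : 0 < s k by rewrite invr_gt0 ltr0n addnS.
have in0pi (x : R) : 0 <= x <= 1 -> x \in `[0, pi]%R.
  move=> /andP[x0 x1]; rewrite in_itv/= x0/=; apply: le_trans x1 _.
  by apply: le_trans (@pi_ge2 R); rewrite ler1n.
have sle k (x : R) : 0 <= x -> x <= (k + N)%:R -> 0 <= s k * x <= 1.
  move=> x0 xk; rewrite mulr_ge0 ?(ltW (s0 k))//=.
  by rewrite mulrC ler_pdivrMr ?mul1r// ltr0n addnS.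
have aN k : a <= (k + N)%:R.
  apply: (@le_trans _ _ N%:R); last by rewrite ler_nat leq_addl.
  by rewrite ltW// /N truncnS_gt.
apply: (same_mean_lim (f_ := fun k x => (cos (s k * x) < cos (s k * a))%R%:R)
  (f := fun x => (a < x)%R%:R)).
- move=> k; apply: (@measurableT_comp _ _ _ _ _ _ (fun b : bool => b%:R : R)) => //.
  apply: measurable_fun_ltr; last exact: measurable_cst.
  by apply: (measurableT_comp (@measurable_cos R)); exact: measurable_funM.
- by move=> k x _; case: (_ < _); rewrite ?normr1 ?normr0.
- move=> k; apply: same_mean_cos_lt; apply: cos_ge0_pihalf.
  have /andP[h0 h1] := sle k a a0 (aN k).
  rewrite (le_trans h1 (@pihalf_ge1 R)) andbT; apply: le_trans h0.
  by rewrite oppr_le0 divr_ge0// pi_ge0.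
- move=> x x0; apply: cvg_near_cst; near=> k; congr ((nat_of_bool _)%:R).
  have xk : x <= (k + N)%:R.
    apply: (@le_trans _ _ k%:R); last by rewrite ler_nat leq_addr.
    by near: k; exact: nbhs_infty_ger.
  rewrite ltr_cos; [|exact/in0pi/sle|exact/in0pi/sle].
  by rewrite ltr_pM2l.
Unshelve. all: by end_near. Qed.

End cosine_transform.

(** * Moment growth, exponential integrability and determinacy *)

Section moments.
Context (d : measure_display) (T : measurableType d) (R : realType).
Context (P : probability T R) (X : {RV P >-> R}).
Hypothesis finX : finite_moments X.

Lemma integrable_abs_exprn (k : nat) :
  P.-integrable setT (EFin \o (fun w => `|X w| ^+ k)).
Proof.
case: k => [|k].
  have := finite_measure_integrable_cst P (1 : R) (measurableT).
  by apply: eq_integrable => // w _ /=; rewrite expr0.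
apply/integrableP; split.
  by apply/measurable_EFinP; apply: measurable_funX; exact: measurableT_comp.
have := finX (ltn0Sn k); rewrite unlock.
by under [X in _ -> (X < _)%E]eq_integral do rewrite /= ger0_norm ?exprn_ge0//.
Qed.

Lemma integrable_exprn (k : nat) :
  P.-integrable setT (EFin \o (fun w => X w ^+ k)).
Proof.
apply: le_integrable (integrable_abs_exprn k) => //.
  by apply/measurable_EFinP; exact: measurable_funX.
by move=> w _ /=; rewrite lee_fin normrX (ger0_norm (exprn_ge0 _ _)).
Qed.

Lemma momentE (k : nat) : moment X k = \int[P]_(w in setT) (X w ^+ k).
Proof. by rewrite /moment unlock. Qed.

Lemma moment_EFin (k : nat) : (\int[P]_w (X w ^+ k)%:E = (moment X k)%:E)%E.
Proof. by rewrite momentE /Rintegral fineK// integrable_fin_num// integrable_exprn. Qed.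

(** The finitely many small orders are absorbed in the constant, since
    [k^k >= 1] (also for [k = 0]). *)
Lemma moment_growth_le (a : R) : a <= 2 -> moment_growth X a ->
  exists C : R, forall k : nat, moment X k <= C * (k%:R ^+ k) ^+ 2.
Proof.
move=> a2 /eqO_exP [C C0 [N _ hN]].
exists (C + \sum_(0 <= i < N) `|moment X i|) => k.
have S0 n : 0 <= \sum_(0 <= i < n) `|moment X i| by apply: sumr_ge0.
have k1 : 1 <= k%:R ^+ k :> R.
  by case: k => [|k]; rewrite ?expr0// exprn_ege1// ler1n.
have k2 : 1 <= (k%:R ^+ k) ^+ 2 :> R by rewrite exprn_ege1.
have [Nk|kN] := leqP N k.
  apply: le_trans (ler_norm _) _; apply: le_trans (hN k Nk) _ => /=.
  rewrite ger0_norm ?powR_ge0//.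
  apply: ler_pM; rewrite ?powR_ge0 ?(ltW C0) ?lerDl//.
  case: k {k1 k2 Nk} => [|k]; first by rewrite mulr0 powRr0 expr0 expr1n.
  rewrite -exprM -powR_mulrn// ler_powR ?ler1n// natrM mulrC ler_wpM2l//.
apply: le_trans (ler_norm _) _.
rewrite -[leLHS]mulr1; apply: ler_pM => //.
rewrite -[leLHS]add0r lerD ?(ltW C0)// (bigD1_seq k) ?iota_uniq ?mem_index_iota//=.
by rewrite lerDl sumr_ge0.
Qed.

(** [sqrt |X|^n] is the square root of [|X|^n], so [integral_root_le] turns the
    hypothesis into [E sqrt |X|^n = O ((b n)^n)]. *)
Lemma integrable_expR_sqrt (C b : R) : 0 < b ->
  (forall k : nat, \int[P]_w (`|X w| ^+ k)%:E <= (C * ((b * k%:R) ^+ k) ^+ 2)%:E)%E ->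
  exists2 c : R, 0 < c & P.-integrable setT
    (EFin \o (fun w => expR (c * Num.sqrt `|X w|))).
Proof.
move=> b0 hX.
have ms : measurable_fun setT (fun w => Num.sqrt `|X w|).
  by apply: (measurableT_comp (@measurable_sqrt R)); exact: measurableT_comp.
apply: (@integrable_expR_of_moments _ _ _ P _ ((C + 1) / 2) b) => //.
- exact: (ltW b0).
move=> n; apply: integral_root_le.
- exact: measurable_funX.
- by move=> w; rewrite exprn_ge0 ?sqrtr_ge0.
- case: n => [|n]; first by rewrite expr0.
  by rewrite exprn_gt0// mulr_gt0// ltr0n.
under eq_integral do rewrite -exprM mulnC exprM sqr_sqrtr//.
exact: hX.
Qed.

Lemma cdf_tail (r : R) :
  cdf X r = (1 - \int[P]_(w in setT) (r < X w)%R%:R)%:E.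
Proof.
have mA : measurable [set w | r < X w].
  rewrite (_ : [set w | _] = X @^-1` `]r, +oo[%classic).
    by rewrite -[X in measurable X]setTI; exact: measurable_funP.
  by apply/seteqP; split=> w /=; rewrite in_itv/= andbT.
have -> : \int[P]_(w in setT) (r < X w)%R%:R = fine (P [set w | r < X w]).
  rewrite /Rintegral -[in RHS](setIT [set w | _]) -(integral_indic P measurableT mA).
  congr fine; apply: eq_integral => w _; rewrite indicE.
  by congr (_%:R%:E); rewrite mem_setE.
rewrite EFinB fineK ?fin_num_measure// -probability_setC//.
rewrite /cdf /distribution /pushforward; congr (P _).
by apply/seteqP; split=> w /=; rewrite in_itv/= leNgt => /negP.
Qed.

End moments.

Lemma integrable_expR_le (d : measure_display) (T : measurableType d) (R : realType)
    (P : probability T R) (V : T -> R) (c c' : R) :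
  measurable_fun setT V -> (forall w, 0 <= V w) -> c' <= c ->
  P.-integrable setT (EFin \o (fun w => expR (c * V w))) ->
  P.-integrable setT (EFin \o (fun w => expR (c' * V w))).
Proof.
move=> mV V0 cc ic; apply: le_integrable ic => //.
  by apply/measurable_EFinP; apply: measurableT_comp => //; exact: measurable_funM.
by move=> w _ /=; rewrite lee_fin !ger0_norm ?expR_ge0// ler_expR ler_wpM2r.
Qed.

Section determinacy.
Context (d : measure_display) (T : measurableType d) (R : realType).
Context (P : probability T R) (X : {RV P >-> R}).
Hypothesis X0 : forall w, 0 <= X w.
Hypothesis finX : finite_moments X.

Let abs_moment_bound (C : R) : (forall k : nat, moment X k <= C * (k%:R ^+ k) ^+ 2) ->
  forall k : nat, (\int[P]_w (`|X w| ^+ k)%:E <= (C * ((1 * k%:R) ^+ k) ^+ 2)%:E)%E.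
Proof.
move=> hC k; under eq_integral do rewrite (ger0_norm (X0 _)).
by rewrite moment_EFin// lee_fin mul1r.
Qed.

Lemma hardy_of_moment_bound (C : R) :
  (forall k : nat, moment X k <= C * (k%:R ^+ k) ^+ 2) -> hardy_condition X.
Proof.
move=> /abs_moment_bound /(integrable_expR_sqrt ltr01) [c c0 ic].
exists c => //; rewrite unlock; have /integrableP [_] := ic.
apply: le_lt_trans; rewrite le_eqVlt; apply/orP; left; apply/eqP.
apply: eq_integral => w _ /=.
by rewrite ger0_norm ?expR_ge0// (ger0_norm (X0 w)).
Qed.

(** Only even moments of [Y] are absolute moments, which is why the bound is
    first extended to [|Y|^k] at the price of replacing [k] by [2 k]. *)
Lemma M_det_of_moment_bound (C : R) :
  (forall k : nat, moment X k <= C * (k%:R ^+ k) ^+ 2) -> M_det X.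
Proof.
move=> hC d' T' Q Y finY XY.
have [c1 c10 ic1] := integrable_expR_sqrt ltr01 (abs_moment_bound hC).
have XY0 k : moment Y k = moment X k.
  case: k => [|k]; last exact: XY.
  rewrite !momentE; under eq_Rintegral do rewrite expr0.
  by under [in RHS]eq_Rintegral do rewrite expr0; rewrite !Rintegral_cst//= !probability_setT.
have [c2 c20 ic2] : exists2 c : R, 0 < c & Q.-integrable setT
    (EFin \o (fun w => expR (c * Num.sqrt `|Y w|))).
  apply: (@integrable_expR_sqrt _ _ _ Q Y ((C + 1) / 2) 2) => // k.
  apply: integral_root_le => //.
  - by apply: measurable_funX; exact: measurableT_comp.
  - case: k => [|k]; first by rewrite expr0 expr1n.
    by rewrite exprn_gt0// exprn_gt0// mulr_gt0// ltr0n.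
  have -> : (\int[Q]_y ((`|Y y| ^+ k) ^+ 2)%:E = \int[Q]_y (Y y ^+ (2 * k))%:E)%E.
    apply: eq_integral => y _; congr EFin.
    by rewrite -exprM mulnC !exprM real_normK// num_real.
  rewrite moment_EFin// XY0 lee_fin; apply: le_trans (hC _) _.
  by rewrite natrM mulnC exprM.
pose c := Num.min c1 c2.
have c0 : 0 < c by rewrite lt_min c10.
have ms (d1 : measure_display) (T1 : measurableType d1) (Z : T1 -> R)
    (mZ : measurable_fun setT Z) : measurable_fun setT (fun w => Num.sqrt `|Z w|).
  by apply: (measurableT_comp (@measurable_sqrt R)); exact: measurableT_comp.
have mX : measurable_fun setT X := measurable_funP X.
have mY : measurable_fun setT Y := measurable_funP Y.
have cc1 : c <= c1 by rewrite ge_min lexx.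
have cc2 : c <= c2 by rewrite ge_min lexx orbT.
have jc1 := integrable_expR_le (ms _ _ _ mX) (fun w => sqrtr_ge0 _) cc1 ic1.
have jc2 := integrable_expR_le (ms _ _ _ mY) (fun w => sqrtr_ge0 _) cc2 ic2.
have eqm k : \int[P]_(w in setT) (X w ^+ k) = \int[Q]_(y in setT) (Y y ^+ k).
  by rewrite -!momentE XY0.
have aeY := ae_nonneg mX mY X0 c0 jc1 jc2 eqm.
have tails r := tail_of_cosine_transform _ _ (fun w => sqrtr_ge0 (X w)) (fun y => sqrtr_ge0 (Y y))
  (Rintegral_cos_sqrt_eq mX mY X0 c0 jc1 jc2 eqm) (sqrtr_ge0 r).
have {}tails r : 0 <= r -> \int[P]_(w in setT) (r < X w)%R%:R =
    \int[Q]_(y in setT) (r < Y y)%R%:R.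
  move=> r0; have lts (x : R) : (Num.sqrt r < Num.sqrt x) = (r < x).
    have [x0|x0] := ltP 0 x; first by rewrite ltr_sqrt.
    rewrite (ler0_sqrtr x0) ltNge sqrtr_ge0/=; apply/esym/negbTE.
    by rewrite -leNgt (le_trans x0).
  transitivity (\int[P]_(w in setT) (Num.sqrt r < Num.sqrt (X w))%R%:R).
    by apply: eq_Rintegral => w _; rewrite lts.
  rewrite tails; first by apply: eq_Rintegral => w _; rewrite lts.
  - by apply: (measurableT_comp (@measurable_sqrt R)).
  - by apply: (measurableT_comp (@measurable_sqrt R)).
apply/funext => r; rewrite !cdf_tail; congr (1 - _)%:E.
have [r0|r0] := leP 0 r; first by rewrite tails.
have one (d1 : measure_display) (T1 : measurableType d1) (P1 : probability T1 R)
    (Z : T1 -> R) (mZ : measurable_fun setT Z) : (\forall w \ae P1, 0 <= Z w) ->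
    \int[P1]_(w in setT) (r < Z w)%R%:R = 1.
  move=> Z0; transitivity (\int[P1]_(w in setT) 1); last first.
    by rewrite Rintegral_cst//= probability_setT mul1r.
  rewrite /Rintegral; congr fine; apply: ae_eq_integral => //.
    apply/measurable_EFinP.
    apply: (@measurableT_comp _ _ _ _ _ _ (fun b : bool => b%:R : R)) => //.
    exact: measurable_fun_ltr.
  by apply: filterS Z0 => w w0 _; rewrite (lt_le_trans r0 w0).
by rewrite !one//; exact: aeW.
Qed.
End determinacy.

(** * Vanishing weighted power sums *)

Lemma big_ord_neq (R : comPzRingType) (N : nat) (i : 'I_N) (f : nat -> R) :
  \prod_(j < N | j != i) f j =
  \prod_(0 <= j < i) f j * \prod_(i.+1 <= j < N) f j.
Proof.
have iN := ltn_ord i.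
transitivity (\prod_(0 <= j < N | j != i :> nat) f j); first by rewrite big_mkord.
rewrite (big_cat_nat (n := i)) ?(ltnW iN)//=; congr (_ * _).
  rewrite [LHS]big_nat_cond [RHS]big_nat_cond; apply: eq_bigl => j.
  by rewrite andbT; case: ltnP => //= ji; rewrite neq_ltn ji.
rewrite big_ltn_cond// eqxx /=.
rewrite [LHS]big_nat_cond [RHS]big_nat_cond; apply: eq_bigl => j.
by rewrite andbT; case: ltnP => //= ji; rewrite gtn_eqF// andbT.
Qed.

(** The left-hand side is the coefficient of degree [N - 1] of the interpolation
    polynomial of ['X^k] at [N > k + 1] points, that is, of ['X^k] itself. *)
Lemma lagrange_power_sum (F : fieldType) (x : nat -> F) (N k : nat) :
  injective x -> (k.+1 < N)%N ->
  \sum_(i < N) x i ^+ k / \prod_(j < N | j != i) (x i - x j) = 0.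
Proof.
move=> xinj kN; have N0 : (0 < N)%N by apply: leq_trans kN.
have sX : (size ('X^k : {poly F}) <= N)%N by rewrite size_polyXn ltnW.
have := lagrange_gen N0 xinj sX; move=> /(congr1 (fun p : {poly F} => p`_N.-1)).
have kN1 : (N.-1 == k) = false by apply/negbTE; rewrite -(eqn_add2r 1) !addn1 prednK// gtn_eqF.
rewrite coefXn kN1 coef_sum => h; transitivity (false%:R : F); last by [].
rewrite h; apply: eq_bigr => i _; rewrite lagrangeE//= mulrA -polyCM coefCM.
rewrite hornerXn horner_prod.
have -> : \prod_(j < N | j != i) ('X - (x j)%:P).[x i] =
    \prod_(j < N | j != i) (x i - x j).
  by apply: eq_bigr => j _; rewrite hornerXsubC.
suff -> : (\prod_(j < N | j != i) ('X - (x j)%:P))`_N.-1 = 1 by rewrite mulr1.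
set p := \prod_(_ < N | _) _.
have pm : p \is monic by apply: monic_prod => j _; exact: monicXsubC.
suff sp : size p = N by rewrite -sp -lead_coefE (monicP pm).
rewrite /p -(big_enum _ _ (predC1 i)) size_prod_XsubC -cardE cardC1 card_ord.
by rewrite prednK.
Qed.

Section nodes.
Context (R : realType) (x : nat -> R).
Hypothesis x0 : forall n, 0 < x n.
Hypothesis xS : forall m n, (m < n)%N -> x m < x n.

(** The absolute value of [prod_(m < N, m <> n) (1 - x n / x m)], written
    without absolute values for an increasing sequence [x]; it equals
    [|x n F' (x n)|] for the polynomial [F] with [F 0 = 1] and roots
    [x 0, ..., x (N - 1)]. *)
Definition node_product (N n : nat) : R :=
  \prod_(0 <= m < n) (x n / x m - 1) * \prod_(n.+1 <= m < N) (1 - x n / x m).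

Definition node_weight (N n : nat) : R := x n / node_product N n.

Lemma node_product_gt0 (N n : nat) : 0 < node_product N n.
Proof.
apply: mulr_gt0; rewrite big_nat; apply: prodr_gt0 => m /andP[mn nm].
  by rewrite subr_gt0 ltr_pdivlMr// mul1r xS.
by rewrite subr_gt0 ltr_pdivrMr// mul1r xS.
Qed.

Lemma node_weight_gt0 (N n : nat) : 0 < node_weight N n.
Proof. by rewrite divr_gt0// node_product_gt0. Qed.

(** A further node multiplies the product by a factor below [1]. *)
Lemma node_weight_nd (N n : nat) : (n < N)%N ->
  node_weight N n <= node_weight N.+1 n.
Proof.
move=> nN; rewrite ler_pM2l// lef_pV2 ?posrE ?node_product_gt0//.
rewrite /node_product (big_nat_recr N)//= mulrA ler_piMr ?(ltW (node_product_gt0 _ _))//.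
by rewrite gerBl divr_ge0// ltW.
Qed.

Lemma node_weight_power_sum (N k : nat) : (k.+1 < N)%N ->
  \sum_(0 <= n < N) (-1) ^+ n * node_weight N n * x n ^+ k = 0.
Proof.
move=> kN.
have xinj : injective x.
  by move=> m n e; case: (ltngtP m n) => // /xS; rewrite e ltxx.
rewrite big_mkord.
have E (n : 'I_N) : (-1) ^+ n * node_weight N n * x n ^+ k =
   ((-1) ^+ N.-1 * \prod_(j < N) x j) *
   (x n ^+ k / \prod_(j < N | j != n) (x n - x j)).
  have nN := ltn_ord n.
  have -> : \prod_(j < N | j != n) (x n - x j) =
      (-1) ^+ (N - n.+1) * (\prod_(j < N | j != n) x j) * node_product N n.
    rewrite (big_ord_neq n (fun j => x n - x j)) (big_ord_neq n x) /node_product.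
    have -> : \prod_(0 <= j < n) (x n - x j) =
        \prod_(0 <= j < n) x j * \prod_(0 <= j < n) (x n / x j - 1).
      rewrite -big_split/=; apply: eq_bigr => j _.
      by rewrite mulrBr mulr1 mulrC divfK// gt_eqF.
    have -> : \prod_(n.+1 <= j < N) (x n - x j) =
        (-1) ^+ (N - n.+1) * \prod_(n.+1 <= j < N) x j *
        \prod_(n.+1 <= j < N) (1 - x n / x j).
      rewrite -prodr_const_nat -!big_split/=; apply: eq_bigr => j _.
      by field; rewrite gt_eqF.
    by ring.
  rewrite (bigD1 n)//= /node_weight.
  have Nn : (N.-1 = n + (N - n.+1))%N by rewrite -[N in LHS](subnKC nN).
  rewrite Nn exprD.
  have s0 : (-1 : R) ^+ (N - n.+1) != 0 by rewrite signr_eq0.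
  have d0 : node_product N n != 0 by rewrite gt_eqF ?node_product_gt0.
  have p0 : \prod_(j < N | j != n) x j != 0 by rewrite gt_eqF ?prodr_gt0.
  by field; rewrite s0 d0 p0.
under eq_bigr do rewrite E.
by rewrite -mulr_sumr lagrange_power_sum// mulr0.
Qed.

End nodes.

(** * The perturbed squares *)

Lemma prod_addn_fact (a k : nat) :
  (\prod_(0 <= m < k) (a + m.+1) * a`! = (a + k)`!)%N.
Proof.
elim: k => [|k IHk]; first by rewrite big_nil mul1n addn0.
by rewrite big_nat_recr//= mulnAC IHk addnS factS mulnC.
Qed.

Lemma prod_subn_fact (k : nat) : (\prod_(0 <= m < k) (k - m) = k`!)%N.
Proof.
rewrite big_nat_rev/= add0n -(mul1n k`!) -[RHS]/(0`! * k`!)%N.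
have := prod_addn_fact 0 k; rewrite fact0 muln1 add0n mul1n => <-.
rewrite big_nat [RHS]big_nat; apply: eq_bigr => m /andP[_ mk].
by rewrite add0n subKn.
Qed.

Lemma leq_sqr_fact (N p : nat) : (p <= N)%N ->
  (N`! * N`! <= (N - p)`! * (N + p)`!)%N.
Proof.
elim: p => [|p IHp] pN; first by rewrite subn0 addn0.
apply: leq_trans (IHp (ltnW pN)) _.
rewrite -(subnSK pN) factS addnS factS -mulnA [leqRHS]mulnCA.
by apply: leq_mul => //; rewrite ltnS; apply: leq_trans (leq_subr _ _) (leq_addr _ _).
Qed.

Section squares.
Variable R : realType.

Let sq (m : nat) : R := m.+1%:R ^+ 2.

(** For the nodes [(m + 1)^2] the factors split as
    [(m - n)(m + n + 2) / (m + 1)^2] up to sign and the product telescopes into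
    factorials. *)
Lemma square_node_product (N n : nat) : (n < N)%N ->
  2 * node_product sq N n * (N`!%:R * N`!%:R) = (N - n.+1)`!%:R * (N + n.+1)`!%:R.
Proof.
have sq0 m : 0 < m.+1%:R :> R by rewrite ltr0n.
have f0 m : 0 < m`!%:R :> R by rewrite ltr0n fact_gt0.
elim: N => // N IHN; rewrite ltnS leq_eqVlt => /predU1P[<-|nN].
  rewrite subnn fact0 mul1r /node_product (@big_geq _ _ _ n.+1 n.+1)// mulr1.
  have fE : n`!%:R = \prod_(0 <= m < n) m.+1%:R :> R.
    have := prod_addn_fact 0 n; rewrite fact0 muln1 add0n => <-.
    by rewrite natr_prod.
  have -> : \prod_(0 <= m < n) (sq n / sq m - 1) =
     n`!%:R * (\prod_(0 <= m < n) (n.+1 + m.+1))%:R / (n`!%:R * n`!%:R).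
    have fS : n`!%:R = \prod_(0 <= m < n) (n - m)%:R :> R.
      by rewrite -[in LHS](prod_subn_fact n) natr_prod.
    rewrite {1}fS !fE natr_prod -!big_split/= -prodf_div.
    rewrite big_nat [RHS]big_nat; apply: eq_bigr => m /andP[_ mn].
    rewrite /sq natrD natrB ?(ltnW mn)//.
    by rewrite -!(natr1 n) -!(natr1 m); field; rewrite natr1 gt_eqF.
  have h := prod_addn_fact n.+1 n.
  have fn1 : (n.+1)`!%:R = n.+1%:R * n`!%:R :> R by rewrite factS natrM.
  have -> : (n.+1 + n.+1)`!%:R = (2 * n.+1%:R) *
      ((\prod_(0 <= m < n) (n.+1 + m.+1))%:R * (n.+1)`!%:R) :> R.
    rewrite addnS factS -h !natrM; congr (_ * _).
    by rewrite -addnS natrD; ring.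
  by rewrite fn1; field; rewrite gt_eqF.
have {}IHN := IHN nN.
have e0 : N.+1`!%:R = N.+1%:R * N`!%:R :> R by rewrite factS natrM.
have e1 : (N.+1 - n.+1)`!%:R = (N.+1%:R - n.+1%:R) * (N - n.+1)`!%:R :> R.
  have es : (N.+1 - n.+1 = (N - n.+1).+1)%N by rewrite subSn.
  rewrite es factS natrM; congr (_ * _).
  by rewrite -es natrB// ltnW.
have e2 : (N.+1 + n.+1)`!%:R = (N.+1%:R + n.+1%:R) * (N + n.+1)`!%:R :> R.
  by rewrite -natrD addSn factS natrM.
rewrite e0 e1 e2 /node_product big_nat_recr//=.
transitivity ((N.+1%:R ^+ 2 - n.+1%:R ^+ 2) *
    (2 * node_product sq N n * (N`!%:R * N`!%:R))).
  by rewrite /node_product /sq; field; rewrite gt_eqF.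
by rewrite IHN; ring.
Qed.

Lemma square_node_product_ge (N n : nat) : (n < N)%N ->
  1 / 2 <= node_product sq N n.
Proof.
move=> nN; have h := square_node_product nN.
have f0 : 0 < N`!%:R * N`!%:R :> R by rewrite mulr_gt0 ?ltr0n ?fact_gt0.
have : N`!%:R * N`!%:R <= 2 * node_product sq N n * (N`!%:R * N`!%:R).
  by rewrite h -!natrM ler_nat leq_sqr_fact.
by rewrite -[leLHS]mul1r ler_pM2r//; lra.
Qed.

(** A slowly varying factor: it spreads the squares just enough to make the
    weights decay faster than every power, without changing the growth
    exponent [2] of the moments. *)
Definition slow (m : nat) : R := 1 + ln m.+1%:R.

Definition node (m : nat) : R := (m.+1%:R * slow m) ^+ 2.

Lemma slow_ge1 (m : nat) : 1 <= slow m.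
Proof. by rewrite lerDl ln_ge0// ler1n. Qed.

Lemma slow_gt0 (m : nat) : 0 < slow m.
Proof. exact: lt_le_trans ltr01 (slow_ge1 m). Qed.

Lemma slow_nd (m n : nat) : (m <= n)%N -> slow m <= slow n.
Proof. by move=> mn; rewrite lerD2l ler_ln ?posrE ?ltr0n// ler_nat. Qed.

Lemma node_gt0 (m : nat) : 0 < node m.
Proof. by rewrite exprn_gt0// mulr_gt0 ?slow_gt0. Qed.

Lemma node_lt (m n : nat) : (m < n)%N -> node m < node n.
Proof.
move=> mn; rewrite /node ltr_pXn2r ?nnegrE ?mulr_ge0 ?(ltW (slow_gt0 _))//.
apply: (@lt_le_trans _ _ (n.+1%:R * slow m)).
  by rewrite ltr_pM2r ?slow_gt0// ltr_nat.
by rewrite ler_wpM2l// slow_nd// ltnW.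
Qed.

Lemma node_ratio (m n : nat) : node n / node m = sq n / sq m * (slow n / slow m) ^+ 2.
Proof.
rewrite /node /sq; field.
by rewrite gt_eqF ?slow_gt0//= gt_eqF// nat1r.
Qed.

(** Spreading the nodes only increases each factor.  For [m < n] this uses
    [a b - 1 >= (a - 1) b] when [b >= 1], which also records the gain [b]. *)
Lemma node_product_ge (N n : nat) :
  \prod_(0 <= m < n) (slow n / slow m) ^+ 2 * node_product sq N n <=
  node_product node N n.
Proof.
have sq0 m : 0 < sq m by rewrite exprn_gt0.
rewrite /node_product mulrA -big_split/= big_nat [X in _ <= X * _]big_nat.
rewrite [X in _ * X <= _]big_nat [X in _ <= _ * X]big_nat.
have r1 (m k : nat) : (m <= k)%N -> 1 <= (slow k / slow m) ^+ 2.
  by move=> mk; rewrite exprn_ege1// ler_pdivlMr ?slow_gt0// mul1r slow_nd.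
have q1 (m k : nat) : (m < k)%N -> 1 < sq k / sq m.
  move=> mk; rewrite ltr_pdivlMr// mul1r ltr_pXn2r ?nnegrE// ltr_nat.
  exact: mk.
apply: ler_pM.
- apply: prodr_ge0 => m /andP[_ mn]; rewrite mulr_ge0 ?sqr_ge0// subr_ge0 ltW//.
  exact: q1.
- apply: prodr_ge0 => m /andP[nm _]; rewrite subr_ge0 ler_pdivrMr// mul1r.
  by rewrite ler_pXn2r ?nnegrE// ler_nat ltnW.
- apply: ler_prod => m /andP[_ mn]; rewrite node_ratio.
  have a1 := q1 _ _ mn; have b1 := r1 _ _ (ltnW mn).
  by apply/andP; split; [apply: mulr_ge0; [exact: sqr_ge0|lra]|nra].
- apply: ler_prod => m /andP[nm _]; apply/andP; split.
    rewrite subr_ge0 ler_pdivrMr// mul1r.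
    by rewrite ler_pXn2r ?nnegrE// ler_nat ltnW.
  have -> : node n / node m = (node m / node n)^-1 by rewrite invf_div.
  have -> : sq n / sq m = (sq m / sq n)^-1 by rewrite invf_div.
  rewrite lerD2l lerN2 node_ratio lef_pV2 ?posrE; last 2 first.
  - by rewrite mulr_gt0 ?divr_gt0 ?exprn_gt0 ?divr_gt0 ?slow_gt0.
  - by rewrite divr_gt0.
  by rewrite ler_peMr ?divr_ge0 ?(ltW (sq0 _)) ?(r1 _ _ (ltnW nm)).
Qed.

(** For the indices [m] in the first half, [slow m <= slow n - ln 2], and each of
    these about [n / 2] squared ratios is at least [exp (2 ln 2 / slow n)]. *)
Lemma slow_product_ge (n : nat) :
  expR (ln 2 * n%:R / slow n) <= \prod_(0 <= m < n) (slow n / slow m) ^+ 2.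
Proof.
have sn := slow_gt0 n.
have l2 : 0 < ln 2 :> R by rewrite ln_gt0 ?ltr1n.
pose h := (n.+1)./2.
have hn : (h <= n)%N by rewrite /h; lia.
have nh : (n <= 2 * h)%N by rewrite /h; lia.
rewrite (big_cat_nat (n := h))//=.
have r1 (m : nat) : (m <= n)%N -> 1 <= (slow n / slow m) ^+ 2.
  by move=> mk; rewrite exprn_ege1// ler_pdivlMr ?slow_gt0// mul1r slow_nd.
apply: (@le_trans _ _ (\prod_(0 <= m < h) (expR (ln 2 / slow n)) ^+ 2 *
   \prod_(h <= m < n) 1)); last first.
  apply: ler_pM.
  - by apply: prodr_ge0 => m _; exact: sqr_ge0.
  - by apply: prodr_ge0 => m _; exact: ler01.
  - rewrite big_nat [leRHS]big_nat; apply: ler_prod => m /andP[_ mh]; rewrite sqr_ge0/=.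
    have sm := slow_gt0 m.
    rewrite ler_pXn2r ?nnegrE ?expR_ge0 ?divr_ge0 ?(ltW sn) ?(ltW sm)//.
    have hs : slow m <= slow n - ln 2.
      rewrite /slow -addrA lerD2l lerBrDr -lnM ?posrE// -natrM.
      by rewrite ler_ln ?posrE ?ltr0n ?muln_gt0// ler_nat; move: mh; rewrite /h; lia.
    rewrite ler_pdivlMr// -ler_pdivlMl ?expR_gt0// -expRN.
    apply: le_trans hs _; apply: (@le_trans _ _ ((1 + - (ln 2 / slow n)) * slow n)).
      by rewrite mulrDl mul1r mulNr divfK ?gt_eqF.
    by rewrite ler_wpM2r ?(ltW sn)// expR_ge1Dx.
  - rewrite big_nat [leRHS]big_nat; apply: ler_prod => m /andP[_ mn].
    by rewrite ler01/= r1// ltnW.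
rewrite prodr_const_nat subn0 big1// mulr1 -exprM -expRM_natl ler_expR.
rewrite mulrAC mulrC ler_wpM2r ?divr_ge0 ?(ltW l2) ?(ltW sn)//.
by rewrite ler_nat.
Qed.

Lemma node_weight_le (N n : nat) : (n < N)%N ->
  node_weight node N n <= 2 * node n * expR (- (ln 2 * n%:R / slow n)).
Proof.
move=> nN; rewrite /node_weight -[leRHS]mulrA [leRHS]mulrCA ler_wpM2l ?(ltW (node_gt0 _))//.
rewrite expRN -[X in X * _]invrK -invfM lef_pV2 ?posrE; last 2 first.
- by apply: node_product_gt0; [exact: node_gt0|exact: node_lt].
- by rewrite mulr_gt0 ?invr_gt0 ?expR_gt0.
have h1 := slow_product_ge n; have h2 := square_node_product_ge nN.
rewrite div1r in h2; apply: le_trans (node_product_ge N n).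
rewrite [leLHS]mulrC; apply: (ler_pM _ _ h1 h2); first exact: expR_ge0.
by rewrite invr_ge0.
Qed.

End squares.

(** * Growth of the moments *)

Lemma ln2_itv (R : realType) : 0 < (ln 2 : R) <= 1.
Proof.
have m1 : -1 < 1 :> R by lra.
by rewrite ln_gt0 ?ltr1n//= -natr1; exact: le_ln1Dx m1.
Qed.

(** In exponential form, the maximum over [w] of [w^q exp (- w)], up to the
    factor [exp (- q)]. *)
Lemma ln_mul_sub_le (R : realType) (q w : R) : 0 < q -> 0 < w ->
  q * ln w - w <= q * ln q.
Proof.
move=> q0 w0; have wq : 0 < w / q by rewrite divr_gt0.
have h := le_ln1Dx (x := w / q - 1).
have {}h : ln (w / q) <= w / q - 1.
  by apply: le_trans (h _); [rewrite subrKC|lra].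
rewrite ln_div ?posrE// in h.
have : q * (ln w - ln q) <= q * (w / q - 1) by rewrite ler_wpM2l// ltW.
by rewrite mulrBr (mulrBr q _ 1) (mulrC q (w / q)) divfK ?gt_eqF//; lra.
Qed.

Section node_moment.
Variable R : realType.
Variable e : R.
Hypothesis e01 : 0 < e < 1.

(** After the bound [slow n <= (n + 1)^e / e], the [k.+1]-st power of a node
    times [(n + 1)^2] is at most a constant multiple of [w^q] with [q = growth_exponent k] and
    [w = ln 2 * e * (n + 1)^(1 - e)]; the factor [(n + 1)^2] is set aside to
    make the sum over [n] converge. *)
Definition growth_exponent (k : nat) : R := ((2 + 2 * e) * k.+1%:R + 2) / (1 - e).

Definition growth_bound (k : nat) : R :=
  growth_exponent k * ln (growth_exponent k)
  - growth_exponent k * ln (ln 2 * e) - 2 * k.+1%:R * ln e.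

Lemma node_moment_le (n k : nat) :
  node R n ^+ k.+1 * expR (- (ln 2 * n%:R / slow R n)) <=
  2 * expR (growth_bound k) / n.+1%:R ^+ 2.
Proof.
have /andP[e0 e1] := e01.
have /andP[l20 l21] := ln2_itv R.
pose p : R := n.+1%:R; pose L := ln p.
have p0 : 0 < p by rewrite ltr0n.
have L0 : 0 <= L by rewrite ln_ge0// ler1n.
have s0 := slow_gt0 R n; have s1 := slow_ge1 R n.
have ls : ln (slow R n) <= e * L - ln e.
  rewrite -ler_expR lnK ?posrE// expRD expRN lnK ?posrE//.
  rewrite ler_pdivlMr//; apply: le_trans (expR_ge1Dx _).
  by rewrite /slow -/p -/L; nra.
have se : slow R n <= expR (e * L) / e.
  rewrite -[leLHS]lnK ?posrE// -[X in _ / X](@lnK _ e) ?posrE// -expRN -expRD.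
  by rewrite ler_expR.
have up : p - 1 = n%:R by rewrite /p -natr1 addrK.
pose w := ln 2 * e * expR ((1 - e) * L).
have w0 : 0 < w by rewrite mulr_gt0 ?expR_gt0// mulr_gt0.
have wle : w <= ln 2 * p / slow R n.
  rewrite ler_pdivlMr// /w -!mulrA ler_wpM2l ?(ltW l20)//.
  apply: (@le_trans _ _ (e * (expR ((1 - e) * L) * (expR (e * L) / e)))).
    by rewrite ler_wpM2l ?(ltW e0)// ler_wpM2l ?expR_ge0.
  have -> : e * (expR ((1 - e) * L) * (expR (e * L) / e)) =
      expR ((1 - e) * L) * expR (e * L) by field; rewrite gt_eqF.
  by rewrite -expRD -mulrDl subrK mul1r lnK ?posrE.
have lw : ln w = ln (ln 2 * e) + (1 - e) * L.
  by rewrite /w lnM ?posrE ?expR_gt0 ?mulr_gt0// expRK.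
have xE : node R n ^+ k.+1 = expR (k.+1%:R * (2 * (L + ln (slow R n)))).
  by rewrite !expRM_natl expRD !lnK ?posrE.
have pE : p ^+ 2 = expR (2 * L) by rewrite expRM_natl lnK ?posrE.
rewrite -/p pE xE -expRN -[X in X * expR (growth_bound k)]lnK ?posrE// -!expRD ler_expR.
set K : R := k.+1%:R; have K0 : 0 < K by rewrite ltr0n.
pose q := growth_exponent k.
have q0 : 0 < q.
  by rewrite divr_gt0//; [rewrite addr_gt0// mulr_gt0//; lra|lra].
have qE : q * (1 - e) = (2 + 2 * e) * K + 2.
  by rewrite /q /growth_exponent divfK// gt_eqF//; lra.
have hq := ln_mul_sub_le q0 w0.
have hn : ln 2 * n%:R / slow R n = ln 2 * p / slow R n - ln 2 / slow R n.
  by rewrite -up; field; rewrite gt_eqF.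
have hs : ln 2 / slow R n <= ln 2 by rewrite ler_pdivrMr// ler_peMr// ltW.
rewrite hn /growth_bound -/q -/K.
have hK : K * (2 * (L + ln (slow R n))) <= K * (2 * (L + (e * L - ln e))).
  by rewrite ler_wpM2l ?(ltW K0)//; lra.
have hL : ((2 + 2 * e) * K + 2) * L = q * (ln w - ln (ln 2 * e)).
  by rewrite -qE lw; ring.
rewrite mulrBr in hL; nra.
Qed.
End node_moment.

(** [growth_exponent e k] grows like [k (2 + 2 e) / (1 - e)], and
    [e = (a - 2) / (2 (a + 2))] makes this slope less than [a]; the difference
    times [k ln k] beats all remaining terms, which are [O(k) + O(ln k)]. *)
Lemma growth_bound_le (R : realType) (a : R) : 2 < a ->
  exists2 e : R, 0 < e < 1 &
  \forall k \near \oo, growth_bound e k <= a * k%:R * ln k%:R.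
Proof.
move=> a2; pose e := (a - 2) / (2 * (a + 2)).
have eE : 2 * (a + 2) * e = a - 2 by rewrite /e; field; lra.
have e0 : 0 < e by rewrite divr_gt0//; lra.
have e1 : e < 1 by rewrite /e ltr_pdivrMr; lra.
exists e; first by rewrite e0.
have /andP[l20 l21] := ln2_itv R.
pose u := (1 - e)^-1.
have u1 : 1 < u by rewrite invf_gt1; lra.
have uE : u * (1 - e) = 1 by rewrite mulVf// gt_eqF//; lra.
pose al := (2 + 2 * e) * u; pose be := al + 2 * u; pose g := al + be.
have al2 : 2 <= al by rewrite /al; nra.
have ala : al < a by rewrite /al; nra.
have be0 : 0 < be by rewrite /be; lra.
have g1 : 1 <= g by rewrite /g; lra.
have lg0 : 0 <= ln g by rewrite ln_ge0.
pose D := - ln (ln 2 * e); pose E := - ln e.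
have D0 : 0 <= D by rewrite oppr_ge0 ln_le0//; nra.
have E0 : 0 <= E by rewrite oppr_ge0 ln_le0// ltW.
(* half of [(a - al) k ln k] pays for the term in [ln k], the other half,
   once [ln k >= M], for the term in [k] *)
pose M := 2 * (g * (ln g + D) + 4 * E) / (a - al).
near=> k.
have k1 : 1 <= k%:R :> R by near: k; exact: nbhs_infty_ger.
have kb : be / (a - al) * 2 <= k%:R by near: k; exact: nbhs_infty_ger.
have kM : expR M <= k%:R by near: k; exact: nbhs_infty_ger.
have k0 : 0 < k%:R :> R by apply: lt_le_trans k1.
have lk : M <= ln k%:R by rewrite -ler_expR lnK ?posrE.
have lk0 : 0 <= ln k%:R :> R by rewrite ln_ge0.
pose q := growth_exponent e k.
have qE : q = al * k%:R + be.
  by rewrite /q /growth_exponent -/u /be /al -natr1; ring.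
have q0 : 0 < q by rewrite qE addr_gt0// mulr_gt0//; lra.
have qg : q <= g * k%:R by rewrite qE /g; nra.
have lq : ln q <= ln g + ln k%:R.
  by rewrite -lnM ?posrE ?ler_ln ?posrE//; [rewrite mulr_gt0//; lra|lra].
have h1 : be * 2 <= (a - al) * k%:R.
  by move: kb; rewrite mulrAC ler_pdivrMr ?subr_gt0// [k%:R * _]mulrC.
have h2 : 2 * (g * (ln g + D) + 4 * E) <= (a - al) * ln k%:R.
  by move: lk; rewrite /M ler_pdivrMr ?subr_gt0// [ln k%:R * _]mulrC.
have -> : growth_bound e k = q * (ln q + D) + 2 * k.+1%:R * E.
  by rewrite /growth_bound -/q /D /E; ring.
have s1 : q * (ln q + D) <= q * (ln g + ln k%:R + D).
  by rewrite ler_wpM2l ?(ltW q0)//; lra.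
have s2 : q * (ln g + D) <= g * k%:R * (ln g + D) by rewrite ler_wpM2r//; lra.
have s3 : 2 * k.+1%:R * E <= 4 * k%:R * E by rewrite ler_wpM2r// -natr1; lra.
have s4 : be * 2 * ln k%:R <= (a - al) * k%:R * ln k%:R by rewrite ler_wpM2r.
have s5 : 2 * (g * (ln g + D) + 4 * E) * k%:R <= (a - al) * ln k%:R * k%:R.
  by rewrite ler_wpM2r ?(ltW k0).
have s6 : q * ln k%:R = al * k%:R * ln k%:R + be * ln k%:R by rewrite qE mulrDl.
nra.
Unshelve. all: by end_near. Qed.

(** * Discrete probability measures *)

Section discrete.
Context (R : realType) (p : nat -> R).
Hypothesis p0 : forall n, 0 <= p n.
Hypothesis p1 : (\sum_(0 <= n <oo) (p n)%:E = 1)%E.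

Let atoms (n : nat) : {measure set nat -> \bar R} := mscale (NngNum (p0 n)) \d_n.

Definition discrete_prob of (\sum_(0 <= n <oo) (p n)%:E = 1)%E :
  set nat -> \bar R := mseries atoms 0.

HB.instance Definition _ := Measure.on (discrete_prob p1).

Let discrete_prob_setT : discrete_prob p1 setT = 1%E.
Proof.
rewrite -p1 /discrete_prob /mseries; apply: eq_eseriesr => n _.
by rewrite /atoms /= /mscale /= diracT mule1.
Qed.

HB.instance Definition _ := @Measure_isProbability.Build _ _ R
  (discrete_prob p1) discrete_prob_setT.

Lemma integral_discrete_prob (f : nat -> R) : (forall n, 0 <= f n) ->
  (\int[discrete_prob p1]_n (f n)%:E = \sum_(0 <= n <oo) (p n * f n)%:E)%E.
Proof.
move=> f0; have mf : measurable_fun setT (EFin \o f) by [].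
rewrite ge0_integral_measure_series//; last by move=> n _; rewrite lee_fin.
apply: eq_eseriesr => n _.
rewrite ge0_integral_mscale//=; last by move=> m _; rewrite lee_fin.
by rewrite integral_dirac// diracT mul1e.
Qed.

Lemma discrete_prob_set1 (N : nat) : discrete_prob p1 [set N] = (p N)%:E.
Proof.
rewrite /discrete_prob /mseries (nneseriesD1 (n := N))//.
rewrite eseries0 => [|n _ /= nN].
  by rewrite adde0 /atoms /= /mscale /= diracE mem_set// mule1.
by rewrite /atoms /= /mscale /= diracE memNset ?mule0//= => e; rewrite e eqxx in nN.
Qed.

End discrete.

Lemma eseries_EFin (R : realType) (u : nat -> R) (l : R) :
  series u n @[n --> \oo] --> l -> (\sum_(0 <= n <oo) (u n)%:E = l%:E)%E.
Proof.
move=> ul; rewrite -(cvg_lim _ ul)// -EFin_lim; last by apply/cvg_ex; eexists; exact: ul.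
by apply: congr_lim; apply/funext => n /=; rewrite /series/= sumEFin.
Qed.

Lemma sum_inv_sqr_le (R : realFieldType) (N : nat) :
  \sum_(0 <= n < N) (n.+1%:R ^+ 2)^-1 <= 2 - N%:R^-1 :> R.
Proof.
elim: N => [|N IHN]; first by rewrite big_nil invr0 subr0.
rewrite big_nat_recr//=; case: N IHN => [_|N IHN].
  by rewrite big_nil add0r expr1n invr1; lra.
apply: le_trans (lerD IHN (lexx _)) _.
have a0 : 0 < N.+1%:R :> R by rewrite ltr0n.
rewrite -!(natr1 N.+1); set a := N.+1%:R in a0 *.
rewrite -subr_ge0.
have -> : 2 - (a + 1)^-1 - (2 - a^-1 + ((a + 1) ^+ 2)^-1) = (a * (a + 1) ^+ 2)^-1.
  by field; lra.
by rewrite invr_ge0 mulr_ge0 ?sqr_ge0// ltW.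
Qed.

(** * An indeterminate law with moments of nearly critical growth *)

Section weights.
Variable R : realType.
Local Notation x := (node R).

Let x0 n : 0 < x n. Proof. exact: node_gt0. Qed.
Let xS m n : (m < n)%N -> x m < x n. Proof. exact: node_lt. Qed.

Let weight_nd n : nondecreasing_seq (fun N => node_weight x N n).
Proof.
apply/nondecreasing_seqP => N; have [nN|Nn] := ltnP n N; first exact: node_weight_nd.
by rewrite /node_weight /node_product !(@big_geq _ _ _ n.+1)// ltnW.
Qed.

Let weight_ub n N : node_weight x N n <= 2 * x n * expR (- (ln 2 * n%:R / slow R n)).
Proof.
apply: (@le_trans _ _ (node_weight x (maxn N n.+1) n)).
  by apply: weight_nd; exact: leq_maxl.
by apply: node_weight_le; rewrite leq_maxr.
Qed.

Definition limit_weight (n : nat) : R := limn (fun N => node_weight x N n).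

Lemma node_weight_is_cvg n : cvgn (fun N => node_weight x N n).
Proof.
apply: nondecreasing_is_cvgn => //.
by exists (2 * x n * expR (- (ln 2 * n%:R / slow R n))) => _ [N _ <-].
Qed.

Lemma node_weight_le_limit N n : node_weight x N n <= limit_weight n.
Proof. exact: nondecreasing_cvgn_le (@weight_nd n) (@node_weight_is_cvg n) N. Qed.

Lemma limit_weight_gt0 n : 0 < limit_weight n.
Proof.
apply: lt_le_trans (node_weight_le_limit 0 n).
exact: node_weight_gt0.
Qed.

Lemma limit_weight_moment_le (e : R) (n k : nat) : 0 < e < 1 ->
  limit_weight n * x n ^+ k <= 4 * expR (growth_bound e k) * (n.+1%:R ^+ 2)^-1.
Proof.
move=> e01.
have wub : limit_weight n <= 2 * x n * expR (- (ln 2 * n%:R / slow R n)).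
  by apply: limr_le; [exact: node_weight_is_cvg|apply: nearW => N].
apply: le_trans (ler_wpM2r (exprn_ge0 k (ltW (x0 n))) wub) _.
have := node_moment_le e01 n k; rewrite exprS => h.
have -> : 2 * x n * expR (- (ln 2 * n%:R / slow R n)) * x n ^+ k =
  2 * (x n * x n ^+ k * expR (- (ln 2 * n%:R / slow R n))) by ring.
have -> : 4 * expR (growth_bound e k) * (n.+1%:R ^+ 2)^-1 =
  2 * (2 * expR (growth_bound e k) / n.+1%:R ^+ 2) by ring.
by rewrite ler_wpM2l.
Qed.

Lemma series_limit_weight_moment_le (e : R) (k N : nat) : 0 < e < 1 ->
  series (fun n => limit_weight n * x n ^+ k) N <= 8 * expR (growth_bound e k).
Proof.
move=> e01; rewrite /series/=.
apply: (@le_trans _ _ (\sum_(0 <= n < N) 4 * expR (growth_bound e k) * (n.+1%:R ^+ 2)^-1)).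
  by apply: ler_sum => n _; exact: limit_weight_moment_le.
rewrite -mulr_sumr; have h := sum_inv_sqr_le R N.
have N0 : 0 <= N%:R^-1 :> R by rewrite invr_ge0.
have g0 := expR_gt0 (growth_bound e k).
have -> : 8 * expR (growth_bound e k) = 4 * expR (growth_bound e k) * 2 by ring.
have g1 : 0 <= 4 * expR (growth_bound e k) by rewrite mulr_ge0// ltW.
by rewrite ler_wpM2l//; lra.
Qed.

Lemma series_limit_weight_moment_is_cvg (k : nat) :
  cvgn (series (fun n => limit_weight n * x n ^+ k)).
Proof.
apply: nondecreasing_is_cvgn.
  apply: nondecreasing_series => n _ _.
  apply: mulr_ge0; first exact: ltW (limit_weight_gt0 _).
  by apply: exprn_ge0; exact: ltW (x0 _).
exists (8 * expR (growth_bound (1 / 2) k)) => _ [N _ <-].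
by apply: series_limit_weight_moment_le; lra.
Qed.

End weights.

Section indeterminate.
Variable R : realType.
Local Notation x := (node R).

Let x0 n : 0 < x n. Proof. exact: node_gt0. Qed.
Let xk0 n k : 0 <= x n ^+ k. Proof. by rewrite exprn_ge0 ?(ltW (x0 n)). Qed.
Let w0 n : 0 < limit_weight R n. Proof. exact: limit_weight_gt0. Qed.

Let W : R := limn (series (limit_weight R)).

Let cvgW : series (limit_weight R) n @[n --> \oo] --> W.
Proof.
have := @series_limit_weight_moment_is_cvg R 0.
have -> // : (fun n => limit_weight R n * x n ^+ 0) = limit_weight R.
by apply/funext => n; rewrite expr0 mulr1.
Qed.

Let W0 : 0 < W.
Proof.
apply: lt_le_trans (w0 0%N) _; have h := nondecreasing_cvgn_le _ cvgW 1%N.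
have -> : limit_weight R 0 = series (limit_weight R) 1 by rewrite /series/= big_nat1.
apply: h; apply: nondecreasing_series => n _ _; exact: ltW.
Qed.

Let p (n : nat) : R := limit_weight R n / W.

Let p0 n : 0 <= p n. Proof. by rewrite divr_ge0// ltW. Qed.

Let cvg_p k : series (fun n => p n * x n ^+ k) N @[N --> \oo] -->
  limn (series (fun n => limit_weight R n * x n ^+ k)) / W.
Proof.
rewrite (_ : series _ = (fun N => series (fun n => limit_weight R n * x n ^+ k) N / W)).
  by apply: cvgMl; exact: series_limit_weight_moment_is_cvg.
apply/funext => N; rewrite /series/= mulr_suml; apply: eq_bigr => n _.
by rewrite /p mulrAC.
Qed.

Let p1 : (\sum_(0 <= n <oo) (p n)%:E = 1)%E.
Proof.
apply: eseries_EFin; rewrite -[X in _ --> X](divff (lt0r_neq0 W0)).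
rewrite (_ : series _ = (fun N => series (limit_weight R) N / W)); first exact: cvgMl cvgW.
by apply/funext => N; rewrite /series/= mulr_suml.
Qed.

Let P : probability nat R := discrete_prob p0 p1.

Let moment_bound (e : R) (k : nat) : 0 < e < 1 ->
  (\int[P]_n (x n ^+ k)%:E <= (8 / W * expR (growth_bound e k))%:E)%E.
Proof.
move=> e01; rewrite integral_discrete_prob// (eseries_EFin (@cvg_p k)) lee_fin.
rewrite mulrAC ler_wpM2r ?invr_ge0 ?(ltW W0)//.
apply: limr_le; first exact: series_limit_weight_moment_is_cvg.
by apply: nearW => N; exact: series_limit_weight_moment_le.
Qed.

Let integral_trunc (g : nat -> R) (N : nat) : (forall n, 0 <= g n) ->
  (\int[P]_n (if (n < N)%N then g n else 0)%:E =
   (\sum_(0 <= n < N) p n * g n)%:E)%E.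
Proof.
move=> g0; rewrite integral_discrete_prob; last by move=> n; case: ifP.
apply: eseries_EFin; apply: cvg_near_cst; exists N => //= M /= NM.
rewrite /series/= (big_cat_nat (n := N))//=.
rewrite [X in _ + X](_ : _ = 0) ?addr0.
  by apply: eq_big_nat => n /andP[_ ->].
by rewrite big_nat big1// => n /andP[Nn _]; rewrite ltnNge Nn mulr0.
Qed.

Let integrable_xk k : P.-integrable setT (EFin \o (fun n => x n ^+ k)).
Proof.
apply/integrableP; split=> //.
under eq_integral do rewrite /= ger0_norm//.
apply: le_lt_trans (moment_bound k (e := 1 / 2) _) (ltry _); lra.
Qed.

(** This is [sum_n (-1)^n w_n x_n^k = 0].  Truncating to [n < N] and replacing
    [w_n] by the weight of the [N]-th stage makes the alternating sum vanish
    exactly; the ratio of the weights is at most [1], so dominated convergence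
    under [P] itself gives the limit.  Keeping the term [1] makes all the
    integrands nonnegative. *)
Let integral_alternating k :
  \int[P]_(n in setT) ((1 + (-1) ^+ n) * x n ^+ k) = \int[P]_(n in setT) (x n ^+ k).
Proof.
pose r N n := node_weight x N n / limit_weight R n.
have r0 N n : 0 <= r N n.
  by rewrite divr_ge0 ?(ltW (w0 n))// ltW// node_weight_gt0//; exact: node_lt.
have r1 N n : r N n <= 1.
  by rewrite ler_pdivrMr// mul1r node_weight_le_limit.
have sr N n : 0 <= 1 + (-1) ^+ n * r N n <= 2.
  have := r0 N n; have := r1 N n.
  by rewrite -signr_odd; case: (odd n); rewrite ?expr0 ?expr1 => *; apply/andP; split; lra.
pose g N n := (1 + (-1) ^+ n * r N n) * x n ^+ k.
have g0 N n : 0 <= g N n by rewrite mulr_ge0//; have /andP[] := sr N n.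
pose f N n := if (n < N)%N then g N n else 0.
have [_ cvgf] : P.-integrable setT (EFin \o (fun n => (1 + (-1) ^+ n) * x n ^+ k)) /\
    \int[P]_(n in setT) f N n @[N --> \oo] -->
    \int[P]_(n in setT) ((1 + (-1) ^+ n) * x n ^+ k).
  apply: (@Rintegral_dominated_cvg _ _ R P f _ (fun n => 2 * x n ^+ k)) => //.
  - move=> n; have h : g N n @[N --> \oo] --> (1 + (-1) ^+ n) * x n ^+ k.
      apply: cvgMl; apply: cvgD; first exact: cvg_cst.
      rewrite -[X in _ --> X]mulr1; apply: cvgMr.
      rewrite -(divff (lt0r_neq0 (w0 n))); apply: cvgMl; exact: node_weight_is_cvg.
    apply: cvg_trans h; apply: near_eq_cvg; exists n.+1 => //= N /= nN.
    by rewrite /f nN.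
  - have := integrableZl measurableT 2 (integrable_xk k).
    by apply: eq_integrable => // n _ /=; rewrite EFinM.
  - move=> N n; rewrite /f; case: ifP => _; last by rewrite normr0 mulr_ge0.
    by rewrite ger0_norm// ler_wpM2r//; have /andP[] := sr N n.
have fE N : (k.+1 < N)%N ->
    \int[P]_(n in setT) f N n = series (fun n => p n * x n ^+ k) N.
  move=> kN; rewrite /Rintegral integral_trunc//= /series/=.
  transitivity (\sum_(0 <= n < N) p n * x n ^+ k +
    (\sum_(0 <= n < N) (-1) ^+ n * node_weight x N n * x n ^+ k) * W^-1); last first.
    by rewrite node_weight_power_sum ?mul0r ?addr0//; exact: node_lt.
  rewrite mulr_suml -big_split/=; apply: eq_bigr => n _.
  by rewrite /g /p /r; field; rewrite !gt_eqF.
have -> : \int[P]_(n in setT) (x n ^+ k) = limn (series (fun n => limit_weight R n * x n ^+ k)) / W.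
  by rewrite /Rintegral integral_discrete_prob// (eseries_EFin (@cvg_p k)).
have cvgf' : \int[P]_(n in setT) f N n @[N --> \oo] -->
    limn (series (fun n => limit_weight R n * x n ^+ k)) / W.
  have h := @cvg_p k; apply: cvg_trans h; apply: near_eq_cvg.
  by exists k.+2 => //= N /= kN; rewrite fE.
exact: cvg_unique cvgf cvgf'.
Qed.

Let sgn0 n : 0 <= 1 + (-1) ^+ n :> R.
Proof. by rewrite -signr_odd; case: (odd n); rewrite ?expr0 ?expr1 ?subrr. Qed.

Let q (n : nat) : R := p n * (1 + (-1) ^+ n).

Let q0 n : 0 <= q n. Proof. by rewrite mulr_ge0. Qed.

Let integral_tilted k :
  (\sum_(0 <= n <oo) (q n * x n ^+ k)%:E = \int[P]_n (x n ^+ k)%:E)%E.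
Proof.
transitivity (\int[P]_n ((1 + (-1) ^+ n) * x n ^+ k)%:E)%E.
  rewrite integral_discrete_prob; last by move=> n; rewrite mulr_ge0.
  by apply: eq_eseriesr => n _; rewrite mulrA.
have h := integral_alternating k; rewrite /Rintegral in h.
rewrite -[RHS]fineK ?integrable_fin_num//; last exact: integrable_xk.
rewrite -h fineK// ge0_fin_numE; last first.
  by apply: integral_ge0 => n _; rewrite lee_fin mulr_ge0.
apply: (@le_lt_trans _ _ (\int[P]_n (2 * x n ^+ k)%:E)%E).
  apply: ge0_le_integral => //.
  - by move=> n _; rewrite lee_fin mulr_ge0.
  - move=> n _; rewrite lee_fin ler_wpM2r//.
    by rewrite -signr_odd; case: (odd n); rewrite ?expr0 ?expr1; lra.
under eq_integral do rewrite EFinM.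
rewrite ge0_integralZl_EFin//; last by move=> n _; rewrite lee_fin.
rewrite -[X in (_ * X)%E]fineK ?integrable_fin_num//; last exact: integrable_xk.
by rewrite -EFinM ltry.
Qed.

Let q1 : (\sum_(0 <= n <oo) (q n)%:E = 1)%E.
Proof.
have := integral_tilted 0.
under eq_eseriesr do rewrite expr0 mulr1.
move=> ->; under eq_integral do rewrite expr0.
by rewrite integral_cst//= probability_setT mule1.
Qed.

Let Q : probability nat R := discrete_prob q0 q1.

Let mx : measurable_fun setT (x : nat -> R). Proof. by []. Qed.

HB.instance Definition _ := isMeasurableFun.Build _ _ nat R x mx.

Let X : {RV P >-> R} := x.
Let Y : {RV Q >-> R} := x.

(** [X] and [Y] are the same function on [nat], under [P] and under the law [Q]
    of density [1 + (-1)^n]; the laws differ at the smallest node, whose mass is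
    doubled. *)
Lemma exists_M_indet : exists (d : measure_display) (T : measurableType d)
    (P : probability T R) (X : {RV P >-> R}),
  [/\ forall w : T, 0 <= X w, finite_moments X, M_indet X
    & forall a : R, 2 < a -> moment_growth X a].
Proof.
exists _, nat, P, X.
have Xk k : ('E_P[fun w => (X w ^+ k)%R] = \int[P]_n (x n ^+ k)%:E)%E by rewrite unlock.
have Yk k : ('E_Q[fun w => (Y w ^+ k)%R] = \int[P]_n (x n ^+ k)%:E)%E.
  by rewrite unlock /= integral_discrete_prob// integral_tilted.
have fink k : (\int[P]_n (x n ^+ k)%:E < +oo)%E.
  rewrite -[X in (X < _)%E]fineK ?ltry// integrable_fin_num//; exact: integrable_xk.
have absx k : (fun w : nat => `|x w| ^+ k) = (fun w => x w ^+ k).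
  by apply/funext => n; rewrite ger0_norm ?(ltW (x0 n)).
have finX : finite_moments X.
  move=> k _; have := fink k; rewrite -Xk.
  by congr ((_ < _)%E); congr expectation; rewrite -(absx k).
have finY : finite_moments Y.
  move=> k _; have := fink k; rewrite -Yk.
  by congr ((_ < _)%E); congr expectation; rewrite -(absx k).
split.
- by move=> w; exact: ltW (x0 w).
- exact: finX.
- move=> /(_ _ nat Q Y) h.
  have {}h := h finY (fun k _ => congr1 fine (etrans (Yk k) (esym (Xk k)))).
  have pre : x @^-1` `]-oo, x 0%N]%classic = [set 0%N].
    apply/seteqP; split=> [n /=|_ ->]; rewrite /= in_itv//=.
    by case: n => // n; rewrite leNgt node_lt.
  have := congr1 (fun F => F (x 0%N)) h.
  rewrite /cdf /distribution /pushforward /= pre !discrete_prob_set1 => -[].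
  rewrite /q expr0 => e; have : 0 < p 0%N by rewrite divr_gt0.
  by lra.
move=> a a2; have [e e01 ge] := growth_bound_le a2.
apply/eqO_exP; exists (8 / W); first by rewrite divr_gt0.
near=> k.
have gek : growth_bound e k <= a * k%:R * ln k%:R by near: k.
have k0 : (0 < k)%N by near: k; exists 1%N.
rewrite /moment Xk ger0_norm; last first.
  by apply: fine_ge0; apply: integral_ge0 => n _; rewrite lee_fin.
rewrite ger0_norm ?powR_ge0// /powR gt_eqF ?ltr0n//.
rewrite -lee_fin fineK; last by apply: integrable_fin_num => //; exact: integrable_xk.
apply: le_trans (moment_bound k e01) _; rewrite lee_fin ler_wpM2l//.
  by rewrite divr_ge0// ltW.
by rewrite ler_expR.
Unshelve. all: by end_near. Qed.

End indeterminate.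

Theorem theorem1 (R : realType) :
  (forall (d : measure_display) (T : measurableType d) (P : probability T R)
      (X : {RV P >-> R}) (a : R),
    (forall w : T, 0 <= X w) ->
    finite_moments X ->
    0 < a <= 2 ->
    moment_growth X a ->
    hardy_condition X /\ M_det X)
  /\
  (exists (d : measure_display) (T : measurableType d) (P : probability T R)
      (X : {RV P >-> R}),
    [/\ forall w : T, 0 <= X w,
        finite_moments X,
        M_indet X
      & forall a : R, 2 < a -> moment_growth X a]).
Proof.
split; last exact: exists_M_indet.
move=> d T P X a X0 finX /andP[_ a2] gX.
have [C hC] := moment_growth_le a2 gX.
by split; [exact: hardy_of_moment_bound hC|exact: M_det_of_moment_bound hC].
Qed.
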